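(* Let $X=\Gamma\backslash G$ be a solvmanifold endowed with a $G$-left-invariant complex structure $J$, and let $\mathfrak{g}$ be the Lie algebra of $G$. Suppose that the maps induced by the inclusion of $G$-left-invariant forms into all forms on $X$, $$ i\colon H^\bullet_{dR}(\mathfrak{g};\mathbb{C})\to H^\bullet_{dR}(X;\mathbb{C})\qquad\text{and}\qquad i\colon H^{\bullet,\bullet}_{\overline{\partial}}(\mathfrak{g}_{\mathbb{C}})\to H^{\bullet,\bullet}_{\overline{\partial}}(X), $$ are isomorphisms. Then the map induced by the same inclusion, $$ i\colon H^{\bullet,\bullet}_{BC}(\mathfrak{g}_{\mathbb{C}})\to H^{\bullet,\bullet}_{BC}(X), $$ is also an isomorphism.
   Context: A solvmanifold $X=\Gamma\backslash G$ is a compact quotient of a connected simply-connected solvable (real) Lie group $G$ by a discrete co-compact subgroup $\Gamma$. Objects on $X$ are $G$-left-invariant if their pull-back to $G$ is invariant under left translations of $G$. Write $\mathfrak{g}_{\mathbb{C}}=\mathfrak{g}\otimes_{\mathbb{R}}\mathbb{C}$. A $G$-left-invariant complex structure corresponds to an integrable linear complex structure $J$ on $\mathfrak{g}$; $\wedge^{p,q}\mathfrak{g}_{\mathbb{C}}^*$ denotes the $(p,q)$-component of $\wedge^{p+q}\mathfrak{g}_{\mathbb{C}}^*$ and is identified with the space of $G$-left-invariant $(p,q)$-forms on $X$, with $d=\partial+\overline{\partial}$ the exterior differential (Chevalley–Eilenberg differential on $\wedge^\bullet\mathfrak{g}_{\mathbb{C}}^*$). $\wedge^{p,q}X$ denotes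 the space of smooth global $(p,q)$-forms on $X$. For either $A^{\bullet,\bullet}=\wedge^{\bullet,\bullet}X$ or $A^{\bullet,\bullet}=\wedge^{\bullet,\bullet}\mathfrak{g}_{\mathbb{C}}^*$: $H_{dR}^\bullet$ (complex coefficients) is the cohomology of $d$; $H^{p,q}_{\overline{\partial}}$ is the cohomology of $(A^{p,\bullet},\overline{\partial})$ in degree $q$; and $$H^{p,q}_{BC}=\frac{\ker(d\text{ on }A^{p,q})}{\partial\overline{\partial}(A^{p-1,q-1})}.$$ These are denoted $H_\bullet(X)$ for $\wedge^{\bullet,\bullet}X$ and $H_\bullet(\mathfrak{g}_{\mathbb{C}})$ (or $H_{dR}(\mathfrak{g};\mathbb{C})$) for $\wedge^{\bullet,\bullet}\mathfrak{g}_{\mathbb{C}}^*$. *)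

(* Defs.v *)
From HB Require Import structures.
From mathcomp Require Import all_boot all_order all_algebra generic_quotient.
From mathcomp Require Import all_classical all_reals all_analysis.
From mathcomp Require Import complex ring.

Set Implicit Arguments.
Unset Strict Implicit.
Unset Printing Implicit Defensive.

Import Order.TTheory GRing.Theory Num.Theory.
Import numFieldNormedType.Exports.

Local Open Scope classical_set_scope.
Local Open Scope ring_scope.

(* [f] is of class C^k on the open set [U]: all iterated directional
   derivatives of order at most [k] exist and are continuous on [U]. *)
Fixpoint Ck_on (R : realType) (V W : normedModType R) (k : nat)
    (U : set V) (f : V -> W) : Prop :=
  (forall x, U x -> {for x, continuous f}) /\
  if k is k'.+1 then
    forall v : V, (forall x, U x -> derivable f x v) /\ Ck_on k' U ('D_v f)
  else True.

Definition smooth_on (R : realType) (V W : normedModType R)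
    (U : set V) (f : V -> W) : Prop := forall k, Ck_on k U f.

Section SmoothOnTheory.
Context (R : realType) (V : normedModType R).
Implicit Types (U : set V) (k : nat).

Lemma Ck_on_eq (W : normedModType R) k U (f g : V -> W) :
  open U -> (forall x, U x -> f x = g x) -> Ck_on k U f -> Ck_on k U g.
Proof.
move=> oU; elim: k f g => [|k IHk] f g fg [cf df].
all: have nfg x : U x -> {near x, f =1 g}.
1,3: by move=> Ux; apply: filterS (open_nbhs_nbhs (conj oU Ux)).
all: have cg x (Ux : U x) : {for x, continuous g}.
1,3: by rewrite /prop_for /continuous_at -(fg x Ux);
        exact: cvg_trans (near_eq_cvg (nfg x Ux)) (cf x Ux).
- by split.
- split=> // v; have [dfv Ckf] := df v; split.
  + by move=> x Ux; apply: near_eq_derivable (nfg x Ux) (dfv x Ux).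
  + by apply: IHk Ckf => x Ux; apply: near_eq_derive; exact: nfg.
Qed.

Lemma Ck_onW (W : normedModType R) k U (f : V -> W) :
  Ck_on k.+1 U f -> Ck_on k U f.
Proof.
elim: k f => [|k IHk] f [cf df]; first by split.
by split=> // v; have [dfv /IHk] := df v.
Qed.

Lemma Ck_on_cst (W : normedModType R) k U (w : W) : Ck_on k U (cst w).
Proof.
elim: k w => [|k IHk] w; split=> //; try by move=> x _; exact: cvg_cst.
move=> v; split; first by move=> x _; exact: derivable_cst.
have -> : 'D_v (cst w : V -> W) = cst 0 by apply/funext => x; exact: derive_cst.
exact: IHk.
Qed.

Lemma Ck_onD (W : normedModType R) k U (f g : V -> W) :
  open U -> Ck_on k U f -> Ck_on k U g -> Ck_on k U (f + g).
Proof.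
move=> oU; elim: k f g => [|k IHk] f g [cf df] [cg dg]; split=> //.
1,2: by move=> x Ux; apply: cvgD; [exact: cf|exact: cg].
move=> v; have [dfv Df] := df v; have [dgv Dg] := dg v; split.
  by move=> x Ux; apply: derivableD; [exact: dfv|exact: dgv].
apply: Ck_on_eq (IHk _ _ Df Dg) => // x Ux.
by rewrite deriveD//; [exact: dfv|exact: dgv].
Qed.

Lemma Ck_onM k U (f g : V -> R) :
  open U -> Ck_on k U f -> Ck_on k U g -> Ck_on k U (f * g).
Proof.
move=> oU; elim: k f g => [|k IHk] f g Cf Cg; move: (Cf) (Cg) => [cf df] [cg dg];
  split=> //.
1,2: by move=> x Ux; apply: cvgM; [exact: cf|exact: cg].
move=> v; have [dfv Df] := df v; have [dgv Dg] := dg v; split.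
  by move=> x Ux; apply: derivableM; [exact: dfv|exact: dgv].
apply: Ck_on_eq (Ck_onD oU (IHk _ _ (Ck_onW Cf) Dg) (IHk _ _ (Ck_onW Cg) Df)) => //.
move=> x Ux; rewrite deriveM//; [exact: dfv|exact: dgv].
Qed.

End SmoothOnTheory.

(* A coordinate chart: [phi] maps [dom] homeomorphically onto an open subset
   of R^n, and [psi] is the inverse of [phi] on that subset. *)
Record chart (R : realType) (n : nat) (M : topologicalType) := Chart {
  dom : set M ;
  phi : M -> 'rV[R]_n ;
  psi : 'rV[R]_n -> M ;
  dom_open : open dom ;
  codom_open : open (phi @` dom) ;
  phiK : forall x, dom x -> psi (phi x) = x ;
  phi_continuous : {within dom, continuous phi} ;
  psi_continuous : {within phi @` dom, continuous psi} }.

Definition is_smooth_atlas (R : realType) (n : nat) (M : topologicalType)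
    (A : set (chart R n M)) : Prop :=
  (forall x, exists2 c, A c & dom c x) /\
  (forall c1 c2, A c1 -> A c2 ->
    smooth_on (phi c1 @` (dom c1 `&` dom c2)) (phi c2 \o psi c1)).

#[short(type="groupTopologicalType")]
HB.structure Definition GroupTopological := {G of Group G & Topological G}.

HB.mixin Record isLieGroup (R : realType) (n : nat) G
    of Group G & Topological G := {
  atlas : set (chart R n G) ;
  atlas_smooth : is_smooth_atlas atlas ;
  lie_hausdorff : hausdorff_space G ;
  lie_second_countable : @second_countable G ;
  mulg_continuous : continuous (fun xy : G * G => (xy.1 * xy.2)%g) ;
  invg_continuous : continuous (fun x : G => x^-1%g) ;
  (* 'rV_(n + n) stands for R^n x R^n *)
  mulg_smooth : forall c1 c2 c3, atlas c1 -> atlas c2 -> atlas c3 ->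
    smooth_on
      [set z : 'rV[R]_(n + n) | [/\ (phi c1 @` dom c1) (lsubmx z),
         (phi c2 @` dom c2) (rsubmx z)
       & dom c3 (psi c1 (lsubmx z) * psi c2 (rsubmx z))%g]]
      (fun z => phi c3 (psi c1 (lsubmx z) * psi c2 (rsubmx z))%g) ;
  invg_smooth : forall c1 c2, atlas c1 -> atlas c2 ->
    smooth_on
      [set z : 'rV[R]_n | (phi c1 @` dom c1) z /\ dom c2 (psi c1 z)^-1%g]
      (fun z => phi c2 (psi c1 z)^-1%g) }.

#[short(type="lieGroupType")]
HB.structure Definition LieGroup (R : realType) (n : nat) :=
  {G of isLieGroup R n G & Group G & Topological G}.

(* Every loop is null-homotopic relative to its endpoints. *)
Definition simply_connected (R : realType) (M : topologicalType) : Prop :=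
  forall c : R -> M, {within `[0, 1]%classic, continuous c} -> c 0 = c 1 ->
  exists H : R * R -> M,
    [/\ {within `[0, 1]%classic `*` `[0, 1]%classic, continuous H},
        forall t, 0 <= t <= 1 -> H (0, t) = c t,
        forall t, 0 <= t <= 1 -> H (1, t) = c 0
      & forall s, 0 <= s <= 1 -> H (s, 0) = c 0 /\ H (s, 1) = c 0].

Section Subgroups.
Context (G : groupType).

Definition is_subgroup (H : set G) : Prop :=
  [/\ H 1%g, forall x y, H x -> H y -> H (x * y)%g & forall x, H x -> H x^-1%g].

Definition generated (A : set G) : set G :=
  \bigcap_(H in [set H | is_subgroup H /\ A `<=` H]) H.

Definition commutators (H : set G) : set G :=
  [set z | exists x y, [/\ H x, H y & z = [~ x, y]%g]].

Fixpoint derived_series (k : nat) : set G :=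
  if k is k'.+1 then generated (commutators (derived_series k')) else setT.

Definition solvable_group : Prop := exists k, derived_series k = [set 1%g].

Record subgroup := Subgroup {
  subgroup_set : set G ;
  subgroupP : is_subgroup subgroup_set }.

Variable Gamma : subgroup.

(* [Gamma x = Gamma y] *)
Definition coset_rel (x y : G) : bool := `[< subgroup_set Gamma (y * x^-1)%g >].

Lemma coset_rel_equiv : equiv_class_of coset_rel.
Proof.
have [G1 GM GV] := subgroupP Gamma; split.
- by move=> x; apply/asboolP; rewrite mulgV.
- move=> x y; apply/asbool_equiv_eq; split=> /GV; by rewrite invgF.
- move=> y x z /asboolP xy /asboolP yz; apply/asboolP.
  by have := GM _ _ yz xy; rewrite mulgA mulgVK.
Qed.

Canonical coset_equiv := EquivRelPack coset_rel_equiv.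

End Subgroups.

Definition discrete_subset (T : topologicalType) (D : set T) : Prop :=
  forall x, D x -> exists2 U, nbhs x U & U `&` D = [set x].

(* The coset space Gamma\G, with the quotient topology. *)
Definition coset_space (G : groupTopologicalType) (Gamma : subgroup G) :=
  quotient_topology {eq_quot (coset_equiv Gamma)}%qT.

HB.instance Definition _ (G : groupTopologicalType) (Gamma : subgroup G) :=
  Topological.on (coset_space Gamma).

Definition coset_proj (G : groupTopologicalType) (Gamma : subgroup G)
  : G -> coset_space Gamma := (\pi_(coset_space Gamma))%qT.

Record fun_algebra (R : realType) (M : Type) := FunAlgebra {
  fa_set : set (M -> R[i]) ;
  fa_cst : forall c : R[i], fa_set (cst c) ;
  fa_add : forall f g, fa_set f -> fa_set g -> fa_set (f + g) ;
  fa_mul : forall f g, fa_set f -> fa_set g -> fa_set (f * g) ;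
  fa_conj : forall f, fa_set f -> fa_set (fun x => conjc (f x)) }.

Section ManifoldFunctions.
Context (R : realType) (n : nat) (M : topologicalType) (A : set (chart R n M)).

Definition smooth_function (f : M -> R[i]) : Prop := forall c, A c ->
  smooth_on (phi c @` dom c) (fun z => complex.Re (f (psi c z))) /\
  smooth_on (phi c @` dom c) (fun z => complex.Im (f (psi c z))).

Lemma smooth_function_cst (a : R[i]) : smooth_function (cst a).
Proof. by move=> c _; split=> k; exact: Ck_on_cst. Qed.

Lemma smooth_function_add f g :
  smooth_function f -> smooth_function g -> smooth_function (f + g).
Proof.
move=> sf sg c Ac; have [rf jf] := sf c Ac; have [rg jg] := sg c Ac.
have oU := @codom_open _ _ _ c; split=> k.
- apply: Ck_on_eq (Ck_onD oU (rf k) (rg k)) => // x _.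
  by rewrite /GRing.add/=; case: (f _) => ? ?; case: (g _).
- apply: Ck_on_eq (Ck_onD oU (jf k) (jg k)) => // x _.
  by rewrite /GRing.add/=; case: (f _) => ? ?; case: (g _).
Qed.

Lemma smooth_function_mul f g :
  smooth_function f -> smooth_function g -> smooth_function (f * g).
Proof.
move=> sf sg c Ac; have [rf jf] := sf c Ac; have [rg jg] := sg c Ac.
have oU := @codom_open _ _ _ c; split=> k.
- pose m1 : R := -1.
  have := Ck_onM oU (Ck_on_cst k _ m1) (Ck_onM oU (jf k) (jg k)).
  move=> /(Ck_onD oU (Ck_onM oU (rf k) (rg k))); apply: Ck_on_eq => // x _.
  rewrite !fctE /m1 mulN1r.
  by case: (f _) => ? ?; case: (g _).
- have := Ck_onD oU (Ck_onM oU (rf k) (jg k)) (Ck_onM oU (jf k) (rg k)).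
  apply: Ck_on_eq => // x _; rewrite !fctE.
  by case: (f _) => ? ?; case: (g _).
Qed.

Lemma smooth_function_conj f :
  smooth_function f -> smooth_function (fun x => conjc (f x)).
Proof.
move=> sf c Ac; have [rf jf] := sf c Ac; have oU := @codom_open _ _ _ c; split=> k.
- by apply: Ck_on_eq (rf k) => // x _; case: (f _).
- have := Ck_onM oU (Ck_on_cst k _ (-1 : R)) (jf k); apply: Ck_on_eq => // x _.
  by rewrite !fctE mulN1r; case: (f _).
Qed.

Definition smooth_functions : fun_algebra R M :=
  FunAlgebra smooth_function_cst smooth_function_add smooth_function_mul
    smooth_function_conj.

End ManifoldFunctions.

(* Gamma\G carries the unique smooth structure for which G -> Gamma\G is a
   local diffeomorphism; for this structure, a function on Gamma\G is smooth
   exactly when its pull-back to G is. *)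
Definition quotient_functions (R : realType) (T M : Type) (S : fun_algebra R T)
    (p : T -> M) : fun_algebra R M.
Proof.
apply: (@FunAlgebra R M [set f : M -> R[i] | fa_set S (f \o p)]) => /=.
- by move=> c; exact: fa_cst.
- by move=> f g; exact: fa_add.
- by move=> f g; exact: fa_mul.
- by move=> f; exact: fa_conj.
Defined.

Definition group_functions (R : realType) (n : nat) (G : lieGroupType R n)
  : fun_algebra R G := smooth_functions (@atlas R n G).

Definition coset_functions (R : realType) (n : nat) (G : lieGroupType R n)
    (Gamma : subgroup G) : fun_algebra R (coset_space Gamma) :=
  quotient_functions (@group_functions R n G) (@coset_proj _ Gamma).

Section SmoothFunctionType.
Context (R : realType) (M : Type) (S : fun_algebra R M).

Definition fa_pred : {pred (M -> R[i])} := fun f => `[< fa_set S f >].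

(* The elements of [S] as a type: a commutative algebra over R[i]. *)
Record smooth_fun := SmoothFun {
  smooth_val :> M -> R[i] ;
  smooth_valP : fa_pred smooth_val }.

HB.instance Definition _ := [isSub for smooth_val].
HB.instance Definition _ := [Choice of smooth_fun by <:].

Lemma fa_subring_closed : subring_closed fa_pred.
Proof.
have fN f : fa_set S f -> fa_set S (- f).
  move=> Sf; have -> : - f = cst (-1) * f by apply/funext => x; rewrite !fctE mulN1r.
  by apply: fa_mul => //; exact: fa_cst.
split; first by apply/asboolP; exact: (fa_cst S 1).
- by move=> f g /asboolP Sf /asboolP Sg; apply/asboolP/fa_add => //; exact: fN.
- by move=> f g /asboolP Sf /asboolP Sg; apply/asboolP/fa_mul.
Qed.

Lemma fa_submod_closed : submod_closed fa_pred.
Proof.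
split; first by apply/asboolP; exact: (fa_cst S 0).
move=> a f g /asboolP Sf /asboolP Sg; apply/asboolP; apply: fa_add => //.
have -> : a *: f = cst a * f by apply/funext.
by apply: fa_mul => //; exact: fa_cst.
Qed.

HB.instance Definition _ :=
  GRing.SubChoice_isSubComPzRing.Build _ _ smooth_fun fa_subring_closed.
HB.instance Definition _ :=
  GRing.SubZmodule_isSubLmodule.Build _ _ _ smooth_fun fa_submod_closed.

Lemma conj_fun_subproof (f : smooth_fun) : fa_pred (fun x => conjc (f x)).
Proof. by apply/asboolP/fa_conj/asboolP/smooth_valP. Qed.

Definition conj_fun (f : smooth_fun) : smooth_fun :=
  SmoothFun (conj_fun_subproof f).

End SmoothFunctionType.

Section VectorFields.
Context (R : realType) (M : Type) (S : fun_algebra R M).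
Local Notation A := (smooth_fun S).

(* Complex vector fields, i.e. sections of TM (x) C, as C-linear derivations
   of the algebra of smooth complex-valued functions. *)
Record vfield := VField {
  vf_fun :> A -> A ;
  vf_linear : forall (c : R[i]) f g,
    vf_fun (c *: f + g) = c *: vf_fun f + vf_fun g ;
  vf_leibniz : forall f g, vf_fun (f * g) = vf_fun f * g + f * vf_fun g }.

Implicit Types (V W : vfield) (f g : A).

Lemma vfieldP V W : (forall f, V f = W f) -> V = W.
Proof.
case: V W => [V lV dV] [W lW dW] /= VW.
have E : V = W by apply/funext.
by case: _ / E in lW dW *; congr VField; exact: Prop_irrelevance.
Qed.

HB.instance Definition _ := gen_eqMixin vfield.
HB.instance Definition _ := gen_choiceMixin vfield.

Fact vf_scaleE (c : R[i]) f : c *: f = (c *: (1 : A)) * f.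
Proof. by apply/val_inj/funext => x /=; rewrite !fctE [c *: 1]mulr1. Qed.

Program Definition vf_zero : vfield := @VField (fun=> 0) _ _.
Next Obligation. by move=> */=; rewrite scaler0 addr0. Qed.
Next Obligation. by move=> */=; rewrite mul0r mulr0 addr0. Qed.

Program Definition vf_opp V : vfield := @VField (fun f => - V f) _ _.
Next Obligation. by move=> */=; rewrite vf_linear opprD scalerN. Qed.
Next Obligation. by move=> */=; rewrite vf_leibniz opprD mulNr mulrN. Qed.

Program Definition vf_add V W : vfield := @VField (fun f => V f + W f) _ _.
Next Obligation. by move=> */=; rewrite !vf_linear scalerDr addrACA. Qed.
Next Obligation. by move=> */=; rewrite !vf_leibniz mulrDl mulrDr addrACA. Qed.

Program Definition vf_scale (h : A) V : vfield := @VField (fun f => h * V f) _ _.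
Next Obligation.
move=> h V c f g /=; rewrite vf_linear mulrDr; congr (_ + _).
by rewrite (vf_scaleE c (V f)) mulrCA -vf_scaleE.
Qed.
Next Obligation. by move=> */=; rewrite vf_leibniz mulrDr mulrA; congr (_ + _); rewrite mulrCA. Qed.

Lemma vf_addA : associative vf_add.
Proof. by move=> ? ? ?; apply: vfieldP => f /=; rewrite addrA. Qed.
Lemma vf_addC : commutative vf_add.
Proof. by move=> ? ?; apply: vfieldP => f /=; rewrite addrC. Qed.
Lemma vf_add0 : left_id vf_zero vf_add.
Proof. by move=> ?; apply: vfieldP => f /=; rewrite add0r. Qed.
Lemma vf_addN : left_inverse vf_zero vf_opp vf_add.
Proof. by move=> ?; apply: vfieldP => f /=; rewrite addNr. Qed.

HB.instance Definition _ :=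
  GRing.isZmodule.Build vfield vf_addA vf_addC vf_add0 vf_addN.

Lemma vf_scaleA (h k : A) V : vf_scale h (vf_scale k V) = vf_scale (h * k) V.
Proof. by apply: vfieldP => f /=; rewrite mulrA. Qed.
Lemma vf_scale1 : left_id 1 vf_scale.
Proof. by move=> V; apply: vfieldP => f /=; rewrite mul1r. Qed.
Lemma vf_scaleDr : right_distributive vf_scale +%R.
Proof. by move=> h V W; apply: vfieldP => f /=; rewrite mulrDr. Qed.
Lemma vf_scaleDl V : {morph vf_scale^~ V : h k / h + k}.
Proof. by move=> h k; apply: vfieldP => f /=; rewrite mulrDl. Qed.

HB.instance Definition _ := GRing.Zmodule_isLmodule.Build A vfield
  vf_scaleA vf_scale1 vf_scaleDr vf_scaleDl.

Program Definition bracket V W : vfield :=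
  @VField (fun f => V (W f) - W (V f)) _ _.
Next Obligation. by move=> */=; rewrite !vf_linear scalerBr opprD addrACA. Qed.
Next Obligation.
move=> V W f g /=.
have vD (U : vfield) (f1 f2 : A) : U (f1 + f2) = U f1 + U f2.
  by have := vf_linear U 1 f1 f2; rewrite !scale1r.
rewrite !(vf_leibniz, vD) mulrBl mulrBr.
ring.
Qed.

Program Definition vf_conj V : vfield :=
  @VField (fun f => conj_fun (V (conj_fun f))) _ _.
Next Obligation.
move=> V c f g /=.
have -> : conj_fun (c *: f + g) = (conjc c) *: conj_fun f + conj_fun g.
  by apply/val_inj/funext => x /=; rewrite !fctE rmorphD rmorphM.
apply/val_inj/funext => x /=.
rewrite vf_linear /= !fctE rmorphD; congr (_ + _).
by rewrite [LHS]rmorphM /= conjcK.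
Qed.
Next Obligation.
move=> V f g /=.
have -> : conj_fun (f * g) = conj_fun f * conj_fun g.
  by apply/val_inj/funext => x /=; rewrite !fctE rmorphM.
by apply/val_inj/funext => x /=;
  rewrite vf_leibniz /= !fctE rmorphD !rmorphM /= !conjcK.
Qed.

End VectorFields.

(* [V] and [W] are related by [F : M -> N]: dF(V x) = W (F x) for all x. *)
Definition F_related (R : realType) (M N : Type)
    (S : fun_algebra R M) (T : fun_algebra R N)
    (F : M -> N) (V : vfield S) (W : vfield T) : Prop :=
  forall (h : smooth_fun S) (f : smooth_fun T),
    (forall x, h x = f (F x)) -> forall x, V h x = W f (F x).

Section Forms.
Context (R : realType) (M : Type) (S : fun_algebra R M).
Local Notation A := (smooth_fun S).
Local Notation vf := (vfield S).

(* A k-form is the function sending V_1, ..., V_k to the smooth function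
   omega(V_1, ..., V_k), extended by 0 to the lists of length other than k. *)
Definition cochain := seq vf -> A.

Definition is_form (k : nat) (w : cochain) : Prop :=
  [/\ forall s, size s != k -> w s = 0,
      forall s1 s2 (f : A) V W,
        w (s1 ++ (f *: V + W) :: s2) = f * w (s1 ++ V :: s2) + w (s1 ++ W :: s2)
    & forall s1 s2 s3 V, w (s1 ++ V :: s2 ++ V :: s3) = 0].

Definition del (T : Type) (i : nat) (s : seq T) := take i s ++ drop i.+1 s.

(* Koszul formula:
   dw(V_0, ..., V_k) = sum_i (-1)^i V_i (w(.., ^V_i, ..))
     + sum_(i < j) (-1)^(i+j) w([V_i, V_j], .., ^V_i, .., ^V_j, ..) *)
Definition ext_d (w : cochain) : cochain := fun s =>
  \sum_(i < size s) (-1) ^+ i * (s`_i : vf) (w (del i s)) +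
  \sum_(i < size s) \sum_(j < size s | (i < j)%N)
    (-1) ^+ (i + j) * w (bracket s`_i s`_j :: del i (del j s)).

End Forms.

(* [eta] is the pull-back of [w] along the local diffeomorphism [F]; [eta] is
   determined by its values on the lifts of vector fields on N, which span the
   vector fields on M. *)
Definition is_pullback (R : realType) (M N : Type)
    (S : fun_algebra R M) (T : fun_algebra R N) (F : M -> N)
    (w : cochain T) (eta : cochain S) : Prop :=
  forall s : seq (vfield S * vfield T),
    (forall p, p \in s -> F_related F p.1 p.2) ->
    forall x, eta (unzip1 s) x = w (unzip2 s) (F x).

Section ComplexStructure.
Context (R : realType) (M : Type) (S : fun_algebra R M).
Local Notation A := (smooth_fun S).
Local Notation vf := (vfield S).

Definition cst_fun (c : R[i]) : A := c *: (1 : A).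

(* The complexification of an almost complex structure on TM. *)
Definition almost_complex (J : {linear vf -> vf}) : Prop :=
  (forall V, J (J V) = - V) /\ (forall V, J (vf_conj V) = vf_conj (J V)).

(* Vanishing of the Nijenhuis tensor *)
Definition integrable_structure (J : {linear vf -> vf}) : Prop := forall V W,
  bracket (J V) (J W) = bracket V W + J (bracket (J V) W + bracket V (J W)).

Variable J : {linear vf -> vf}.

Definition is10 (V : vf) : Prop := J V = cst_fun 'i%C *: V.
Definition is01 (V : vf) : Prop := J V = - (cst_fun 'i%C *: V).

Definition proj10 (V : vf) : vf := cst_fun 2^-1 *: (V - cst_fun 'i%C *: J V).
Definition proj01 (V : vf) : vf := cst_fun 2^-1 *: (V + cst_fun 'i%C *: J V).

(* A (p,q)-form is a (p+q)-form that vanishes unless exactly p of its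
   (homogeneous) arguments are of type (1,0). *)
Definition is_pq_form (p q : nat) (w : cochain S) : Prop :=
  is_form (p + q) w /\
  forall s1 s2, (forall V, V \in s1 -> is10 V) -> (forall V, V \in s2 -> is01 V) ->
    size s1 != p -> w (s1 ++ s2) = 0.

(* The component of type (p, k - p) of a k-form *)
Definition pq_component (p : nat) (w : cochain S) : cochain S := fun s =>
  \sum_(b : (size s).-tuple bool | count id b == p)
    w [seq (if x.1 then proj10 x.2 else proj01 x.2) | x <- zip b s].

(* The operators A^{p,q} -> A^{p+1,q} and A^{p,q} -> A^{p,q+1} *)
Definition del_op (p : nat) (w : cochain S) := pq_component p.+1 (ext_d w).
Definition delbar (p : nat) (w : cochain S) := pq_component p (ext_d w).

(* [E k] is the space of k-forms of a given complex of forms. *)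
Section Cohomology.
Variable E : nat -> set (cochain S).

Definition bigraded (p q : nat) : set (cochain S) :=
  E (p + q) `&` is_pq_form p q.

Definition Z_dR (k : nat) := [set w | E k w /\ ext_d w = 0].
Definition B_dR (k : nat) : set (cochain S) :=
  if k is k'.+1 then @ext_d _ _ S @` E k' else [set 0].

Definition Z_Dol (p q : nat) := [set w | bigraded p q w /\ delbar p w = 0].
Definition B_Dol (p q : nat) : set (cochain S) :=
  if q is q'.+1 then delbar p @` bigraded p q' else [set 0].

Definition Z_BC (p q : nat) := [set w | bigraded p q w /\ ext_d w = 0].
Definition B_BC (p q : nat) : set (cochain S) :=
  match p, q with
  | p'.+1, q'.+1 => (del_op p' \o delbar p') @` bigraded p' q'
  | _, _ => [set 0]
  end.

End Cohomology.
End ComplexStructure.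

(* The elements of the quotient Z / B are the classes z + B, z in Z. *)
Definition class_mod (U : zmodType) (B : set U) (z : U) : set U :=
  [set x | B (x - z)].

Definition cohomology (U : zmodType) (Z B : set U) : set (set U) :=
  class_mod B @` Z.

(* The map Z / B -> Z' / B' induced by an inclusion of complexes,
   z + B |-> z + B' *)
Definition induced_map (U : zmodType) (B' : set U) (c : set U) : set U :=
  [set x | exists2 z, c z & B' (x - z)].

Definition induced_iso (U : zmodType) (Z B Z' B' : set U) : Prop :=
  set_bij (cohomology Z B) (cohomology Z' B') (induced_map B').

Section Invariant.
Context (R : realType) (n : nat) (G : lieGroupType R n) (Gamma : subgroup G).

Definition SG : fun_algebra R G := @group_functions R n G.
Definition SX : fun_algebra R (coset_space Gamma) := coset_functions Gamma.

Definition left_translation (g : G) : G -> G := fun x => (g * x)%g.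

Definition all_forms (k : nat) : set (cochain SX) := [set w | is_form k w].

(* The forms on Gamma\G whose pull-back to G is invariant under the left
   translations of G; their space is identified with the k-th exterior power
   of the dual of the complexified Lie algebra of G. *)
Definition invariant_forms (k : nat) : set (cochain SX) :=
  [set w | is_form k w /\
    exists eta : cochain SG,
      [/\ is_form k eta, is_pullback (@coset_proj _ Gamma) w eta
        & forall g, is_pullback (left_translation g) eta eta]].

(* [JG] is the pull-back of [J] to G. *)
Definition invariant_complex_structure (J : {linear vfield SX -> vfield SX}) :=
  exists JG : {linear vfield SG -> vfield SG},
    (forall V W, F_related (@coset_proj _ Gamma) V W ->
       F_related (@coset_proj _ Gamma) (JG V) (J W)) /\
    (forall g V W, F_related (left_translation g) V W ->
       F_related (left_translation g) (JG V) (JG W)).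

End Invariant.

(* Main.v *)
Require Import Defs.
From HB Require Import structures.
From mathcomp Require Import all_boot all_order all_algebra.
From mathcomp Require Import all_classical all_reals all_analysis.
From mathcomp Require Import complex ring.

(** The statement is a formal consequence of the Dolbeault isomorphism, once the
    forms on the quotient and the invariant ones among them are known to be
    first-quadrant double complexes stable under complex conjugation.

    Let B be the double complex of all forms, A the subcomplex of invariant
    ones, and C = B/A. The Dolbeault isomorphism says that C is exact for
    delbar ([delbar_exact]); conjugating forms swaps (p,q) with (q,p) and del
    with delbar, so C is exact for del as well ([del_exact]). Since C lives in
    the first quadrant, a zigzag argument by induction on q then shows that its
    Aeppli cohomology vanishes: if del delbar x = 0 in C, then x = del u + delbar v
    in C ([aeppli_exact]). Both halves of the Bott-Chern isomorphism follow.

    Injectivity: if a in A equals del delbar b with b in B, the class of b in C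
    is del u + delbar v, so b can be replaced by an element of A without changing
    del delbar b ([bc_injective]).

    Surjectivity: let z in B be closed. Exactness for delbar writes z = delbar c
    in C; then del delbar c = 0 in C, so c = del u + delbar v and
    z = delbar del u in C, that is, z differs from an element of A by something
    in the image of del delbar ([bc_surjective]).

    What remains is to see that forms given by the Koszul formula make up such
    double complexes. The tool is Cartan's formula
    i_V d = L_V - d i_V ([cartan]) for the contraction i_V and the Lie
    derivative L_V: it turns each property of d into an induction on the number
    of arguments. In this way d of a form is a form ([ext_d_form]),
    d d = 0 ([ext_d_d]), integrability gives d = del + delbar ([ext_d_pq]), and
    d commutes with conjugation ([ext_d_conj_cochain]) and with pull-backs
    ([pullback_ext_d]); the last point makes the invariant forms stable under d
    ([invariant_closed]). *)

Set Implicit Arguments.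
Unset Strict Implicit.
Unset Printing Implicit Defensive.

Import GRing.Theory.

Local Open Scope classical_set_scope.
Local Open Scope ring_scope.

(** * Vector fields as derivations *)

Lemma del_cons0 (T : Type) (x : T) s : del 0 (x :: s) = s.
Proof. by rewrite /del /= drop0. Qed.

Lemma del_consS (T : Type) i (x : T) s : del i.+1 (x :: s) = x :: del i s.
Proof. by []. Qed.

Section VectorFieldFacts.
Context (R : realType) (M : Type) (S : fun_algebra R M).
Local Notation A := (smooth_fun S).
Local Notation vf := (vfield S).
Implicit Types (U V W : vf) (f g : A).

Lemma vf_addE V W f : (V + W) f = V f + W f. Proof. by []. Qed.
Lemma vf_oppE V f : (- V) f = - V f. Proof. by []. Qed.
Lemma vf_scaledE g V f : (g *: V) f = g * V f. Proof. by []. Qed.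
Lemma bracketE V W f : bracket V W f = V (W f) - W (V f). Proof. by []. Qed.

Lemma vf_is_zmod_morphism V : zmod_morphism (vf_fun V).
Proof.
by move=> f g; have := vf_linear V (-1) g f; rewrite !scaleN1r addrC => ->; rewrite addrC.
Qed.

HB.instance Definition _ V :=
  GRing.isZmodMorphism.Build A A (vf_fun V) (vf_is_zmod_morphism V).

Lemma bracketC V W : bracket V W = - bracket W V.
Proof. by apply: vfieldP => f; rewrite vf_oppE !bracketE opprB. Qed.

Lemma bracketxx V : bracket V V = 0.
Proof. by apply: vfieldP => f; rewrite bracketE subrr. Qed.

Lemma bracketDl U V W : bracket (V + W) U = bracket V U + bracket W U.
Proof.
apply: vfieldP => f; rewrite vf_addE !bracketE !vf_addE raddfD/=; ring.
Qed.

Lemma bracketDr U V W : bracket U (V + W) = bracket U V + bracket U W.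
Proof. by rewrite bracketC bracketDl opprD -!bracketC. Qed.

Lemma bracketZr U V f : bracket U (f *: V) = f *: bracket U V + U f *: V.
Proof.
apply: vfieldP => g; rewrite vf_addE !vf_scaledE !bracketE !vf_scaledE.
by rewrite vf_leibniz; ring.
Qed.

Lemma bracketZl U V f : bracket (f *: V) U = f *: bracket V U - U f *: V.
Proof. by rewrite bracketC bracketZr opprD -scalerN -bracketC. Qed.

Lemma bracket_jacobi U V W :
  bracket (bracket U V) W = bracket U (bracket V W) - bracket V (bracket U W).
Proof.
apply: vfieldP => f; rewrite vf_addE vf_oppE !bracketE !raddfB/=; ring.
Qed.

End VectorFieldFacts.

(** * Cartan calculus on cochains *)

Arguments ext_d : simpl never.

Section Cartan.
Context (R : realType) (M : Type) (S : fun_algebra R M).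
Local Notation A := (smooth_fun S).
Local Notation vf := (vfield S).
Local Notation cochain := (cochain S).
Implicit Types (U V W : vf) (f g : A) (w : cochain) (s : seq vf).

(** Being a form without the condition on the degree, so that contractions stay
    in the same class; alternation is asked for neighbours only, which suffices
    by [is_formP]. *)
Definition alt_cochain w : Prop :=
  (forall s1 s2 f V W,
     w (s1 ++ (f *: V + W) :: s2) = f * w (s1 ++ V :: s2) + w (s1 ++ W :: s2)) /\
  (forall s1 s2 V, w (s1 ++ V :: V :: s2) = 0).

Definition contr V w : cochain := fun s => w (V :: s).

(** The Lie derivative L_V, by recursion through i_U L_V = L_V i_U - i_[V,U]. *)
Fixpoint lie V w s {struct s} : A :=
  if s is U :: s' then lie V (contr U w) s' - w (bracket V U :: s')
  else V (w [::]).

Lemma alternating_contr w V : alt_cochain w -> alt_cochain (contr V w).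
Proof.
by move=> [wl wa]; split=> [s1 s2 f U W|s1 s2 U];
  [exact: (wl (V :: s1))|exact: (wa (V :: s1))].
Qed.

Section Slots.
Variable w : cochain.
Hypothesis walt : alt_cochain w.

Lemma alt_slotD s1 s2 V W :
  w (s1 ++ (V + W) :: s2) = w (s1 ++ V :: s2) + w (s1 ++ W :: s2).
Proof. by have := walt.1 s1 s2 1 V W; rewrite scale1r mul1r. Qed.

Lemma alt_slot0 s1 s2 : w (s1 ++ 0 :: s2) = 0.
Proof. by apply: (addIr (w (s1 ++ 0 :: s2))); rewrite -alt_slotD !add0r. Qed.

Lemma alt_slotZ s1 s2 f V : w (s1 ++ (f *: V) :: s2) = f * w (s1 ++ V :: s2).
Proof. by have := walt.1 s1 s2 f V 0; rewrite alt_slot0 !addr0. Qed.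

Lemma alt_slotN s1 s2 V : w (s1 ++ (- V) :: s2) = - w (s1 ++ V :: s2).
Proof. by rewrite -scaleN1r alt_slotZ mulN1r. Qed.

Lemma alt_swap s1 s2 V W : w (s1 ++ V :: W :: s2) = - w (s1 ++ W :: V :: s2).
Proof.
apply/eqP; rewrite -addr_eq0; apply/eqP.
have aa := walt.2; have := aa s1 s2 (V + W).
rewrite alt_slotD.
have E X : w (s1 ++ X :: (V + W) :: s2) =
    w (s1 ++ X :: V :: s2) + w (s1 ++ X :: W :: s2).
  by have := alt_slotD (rcons s1 X) s2 V W; rewrite !cat_rcons.
by rewrite !E !aa add0r addr0.
Qed.

Lemma alt_move0 s1 s2 s3 V :
  w (s1 ++ V :: s2 ++ s3) = 0 -> w (s1 ++ s2 ++ V :: s3) = 0.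
Proof.
elim: s2 s1 => [|U s2 IH] s1 //= E.
rewrite -cat_rcons; apply: IH; rewrite cat_rcons alt_swap.
by apply/eqP; rewrite oppr_eq0; apply/eqP.
Qed.

End Slots.

Lemma is_formP k w :
  is_form k w <-> (forall s, size s != k -> w s = 0) /\ alt_cochain w.
Proof.
split=> [[w0 wl wa]|[w0 [wl wa]]].
  by split=> //; split=> // s1 s2 V; exact: (wa s1 [::] s2).
split=> // s1 s2 s3 V.
have := @alt_move0 w (conj wl wa) (rcons s1 V) s2 s3 V.
by rewrite !cat_rcons; apply; exact: wa.
Qed.

Lemma ext_d_nil w : ext_d w [::] = 0.
Proof. by rewrite /ext_d /= !big_ord0 addr0. Qed.

Lemma ext_d_is_zmod_morphism : zmod_morphism (@ext_d R M S).
Proof.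
move=> w1 w2; apply/funext => s; rewrite /ext_d !fctE opprD addrACA -!sumrB.
congr (_ + _); apply: eq_bigr => i _; first by rewrite raddfB mulrBr.
by rewrite -sumrB; apply: eq_bigr => j _; rewrite mulrBr.
Qed.

HB.instance Definition _ := GRing.isZmodMorphism.Build cochain cochain
  (@ext_d R M S) ext_d_is_zmod_morphism.

(** The Lie derivative in the shape of the terms of the Koszul formula that
    involve the first argument: moving [V, s_j] to the front costs (-1)^j. *)
Lemma lie_sum w V s : alt_cochain w ->
  lie V w s = V (w s) +
    \sum_(j < size s) (-1) ^+ j.+1 * w (bracket V s`_j :: del j s).
Proof.
elim: s w => [|U s IH] w walt /=; first by rewrite big_ord0 addr0.
rewrite IH; last exact: alternating_contr.
rewrite big_ord_recl /= expr1 mulN1r -addrA; congr (_ + _).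
rewrite del_cons0 [RHS]addrC; congr (_ - _).
apply: eq_bigr => j _; rewrite /contr.
rewrite (alt_swap walt [::]) /bump /= /del /= [in RHS]exprS.
by rewrite mulrN mulN1r mulNr.
Qed.

(** Splitting both sums of the Koszul formula according to whether the first
    argument V is used; the terms which keep V as an argument form d (i_V w), up
    to the sign caused by the shift of the indices. *)
Lemma cartan w V s : alt_cochain w ->
  ext_d w (V :: s) = lie V w s - ext_d (contr V w) s.
Proof.
move=> walt; rewrite lie_sum // /ext_d /= !big_ord_recl /=.
rewrite del_cons0 expr0 mul1r opprD [RHS]addrACA; congr (_ + _ + (_ + _)).
- rewrite -sumrN; apply: eq_bigr => i _.
  by rewrite add0n exprS mulN1r mulNr.
- rewrite big_mkcond big_ord_recl /= add0r.
  by apply: eq_bigr => i _; rewrite del_cons0.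
- rewrite -sumrN; apply: eq_bigr => i _.
  rewrite big_mkcond big_ord_recl /= add0r -big_mkcond /= -sumrN.
  apply: eq_bigr => j _; rewrite /bump /= !add1n !add0n !del_consS.
  rewrite (alt_swap walt [::]) addSn addnS !exprS !mulN1r opprK mulrN.
  by [].
Qed.

Lemma alt_cochain0 : alt_cochain (0 : cochain).
Proof. by split=> [s1 s2 f V W|s1 s2 V] /=; [rewrite -[RHS]/(f * 0 + 0) mulr0 addr0|]. Qed.

Lemma alternatingB w1 w2 :
  alt_cochain w1 -> alt_cochain w2 -> alt_cochain (w1 - w2).
Proof.
move=> [l1 a1] [l2 a2]; split=> [s1 s2 f V W|s1 s2 V]; rewrite !fctE.
  by rewrite l1 l2; ring.
by rewrite a1 a2 subrr.
Qed.

Lemma alternatingM f w : alt_cochain w -> alt_cochain (fun s => f * w s).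
Proof.
move=> [wl wa]; split=> [s1 s2 g V W|s1 s2 V]; last by rewrite wa mulr0.
by rewrite wl; ring.
Qed.

Lemma lie_is_zmod_morphism V : zmod_morphism (lie V).
Proof.
move=> w1 w2; apply/funext => s; elim: s w1 w2 => [|U s IH] w1 w2; rewrite !fctE /=.
  by rewrite raddfB.
rewrite (_ : contr U (w1 - w2) = contr U w1 - contr U w2) // IH !fctE; ring.
Qed.

HB.instance Definition _ V := GRing.isZmodMorphism.Build cochain cochain
  (lie V) (lie_is_zmod_morphism V).

Lemma lieM V f w : lie V (fun s => f * w s) =
  (fun s => f * lie V w s + V f * w s).
Proof.
apply/funext => s; elim: s w => [|U s IH] w /=.
  by rewrite vf_leibniz addrC.
by rewrite (IH (contr U w)) /contr; ring.
Qed.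

(** L_V preserves the number of arguments. *)
Lemma lie_local V w s :
  (forall s', size s' = size s -> w s' = 0) -> lie V w s = 0.
Proof.
elim: s w => [|U s IH] w w0 /=; first by rewrite w0 // raddf0.
rewrite w0 // subr0; apply: IH => s' es; apply: w0 => /=.
by rewrite es.
Qed.

(** In (L_V w)(f U) the term V(f) w(U) from the derivation of f w(U) cancels the
    one from [V, f U] = f [V, U] + V(f) U. *)
Lemma lie_slot_linear V w f U W s : alt_cochain w ->
  lie V w (f *: U + W :: s) = f * lie V w (U :: s) + lie V w (W :: s).
Proof.
move=> walt /=.
have -> : contr (f *: U + W) w = (fun s => f * contr U w s) + contr W w.
  by apply/funext => s'; exact: (walt.1 [::]).
rewrite raddfD /= lieM !fctE bracketDr bracketZr.
rewrite (alt_slotD walt [::]) (alt_slotD walt [::]) !(alt_slotZ walt [::]) /=.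
rewrite /contr; ring.
Qed.

Lemma lie_alternating V w : alt_cochain w -> alt_cochain (lie V w).
Proof.
move=> walt; split=> s1.
  elim: s1 w walt => [|X s1 IH] w walt s2 f U W.
    by rewrite /= -/(lie V w (f *: U + W :: s2)) lie_slot_linear.
  rewrite /= IH; last exact: alternating_contr.
  by rewrite (walt.1 (bracket V X :: s1)); ring.
elim: s1 w walt => [|X s1 IH] w walt s2 U.
  rewrite /=  (_ : contr U (contr U w) = 0) ?raddf0; last first.
    by apply/funext => s; exact: (walt.2 [::]).
  by rewrite -[(0 : cochain) s2]/(0 : A) sub0r /contr (alt_swap walt [::]) /= opprK subrr.
rewrite /= IH; last exact: alternating_contr.
by rewrite (walt.2 (bracket V X :: s1)) subr0.
Qed.

Lemma lieDl V W w s : alt_cochain w ->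
  lie (V + W) w s = lie V w s + lie W w s.
Proof.
elim: s w => [|U s IH] w walt //=; rewrite IH; last exact: alternating_contr.
rewrite bracketDl (alt_slotD walt [::]) /=; ring.
Qed.

(** Neither L_V nor d i_V is tensorial in V, but both fail to be so by the
    exterior product of df with i_V w, so that their difference i_V d is. *)
Lemma lieZl f V w s : alt_cochain w ->
  lie (f *: V) w s - ext_d (fun s => f * contr V w s) s =
  f * (lie V w s - ext_d (contr V w) s).
Proof.
elim: s w => [|U s IH] w walt; first by rewrite /= !ext_d_nil !subr0.
have aV := alternating_contr V walt; have aU := alternating_contr U walt.
rewrite !cartan //; last exact: alternatingM.
have E : contr V (contr U w) = - contr U (contr V w).
  apply/funext => s'; exact: (alt_swap walt [::]).
rewrite /= lieM.
have := IH _ aU.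
rewrite E raddfN /= (_ : (fun s => f * _) =
    - (contr U (fun s => f * contr V w s))); last first.
  by apply/funext => s'; rewrite !fctE mulrN.
rewrite raddfN /= !fctE !opprK => IHU.
rewrite bracketZl (alt_slotD walt [::]) (alt_slotN walt [::]) !(alt_slotZ walt [::]) /=.
have -> : lie (f *: V) (contr U w) s = 
  f * (lie V (contr U w) s + ext_d (contr U (contr V w)) s) -
  ext_d (contr U (fun s0 : seq vf => f * contr V w s0)) s by rewrite -IHU addrK.
rewrite /contr; ring.
Qed.

Lemma contr_ext_d w V : alt_cochain w ->
  contr V (ext_d w) = lie V w - ext_d (contr V w).
Proof. by move=> walt; apply/funext => s; rewrite /contr cartan. Qed.

Lemma ext_d_alternating w : alt_cochain w -> alt_cochain (ext_d w).
Proof.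
move=> walt; split=> s1.
  elim: s1 w walt => [|X s1 IH] w walt s2 f U W.
    rewrite /= !cartan // lieDl //.
    have -> : contr (f *: U + W) w = (fun s => f * contr U w s) + contr W w.
      by apply/funext => s'; exact: (walt.1 [::]).
    rewrite (raddfD (@ext_d R M S)) /= !fctE -lieZl //; ring.
  rewrite /= !cartan // (lie_alternating X walt).1 IH; first by ring.
  exact: alternating_contr.
elim: s1 w walt => [|X s1 IH] w walt s2 U.
  rewrite /= cartan // cartan /=; last exact: alternating_contr.
  rewrite bracketxx (alt_slot0 walt [::]).
  rewrite (_ : contr U (contr U w) = 0) ?raddf0 ?raddf0; last first.
    by apply/funext => s; exact: (walt.2 [::]).
  exact: subrr.
rewrite /= cartan // (lie_alternating X walt).2 IH ?subr0 //.
exact: alternating_contr.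
Qed.

(** d raises the number of arguments by one. *)
Lemma ext_d_local w s : alt_cochain w ->
  (forall s', (size s').+1 = size s -> w s' = 0) -> ext_d w s = 0.
Proof.
elim: s w => [|V s IH] w walt w0; first exact: ext_d_nil.
rewrite cartan // lie_local; last by move=> s' es; apply: w0; rewrite /= es.
rewrite IH ?subr0 //; first exact: alternating_contr.
by move=> s' es; apply: w0; rewrite /= es.
Qed.

Lemma ext_d_form k w : is_form k w -> is_form k.+1 (ext_d w).
Proof.
move=> /is_formP [w0 walt]; apply/is_formP; split; last exact: ext_d_alternating.
move=> s sk; apply: ext_d_local => // s' es; apply: w0.
by apply: contraNneq sk => <-; rewrite es.
Qed.

Lemma lie_bracket U V w s : alt_cochain w ->
  lie (bracket U V) w s = lie U (lie V w) s - lie V (lie U w) s.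
Proof.
elim: s w => [|X s IH] w walt //.
have aX := alternating_contr X walt.
have E Y : contr X (lie Y w) = lie Y (contr X w) - contr (bracket Y X) w by [].
rewrite /= IH // !E !raddfB /= !fctE /= /contr bracket_jacobi.
rewrite (alt_slotD walt [::]) (alt_slotN walt [::]) /=; ring.
Qed.

(** After a contraction with U this reduces, by Cartan's formula, to
    L_[V,U] = L_V L_U - L_U L_V and to the same statement for i_U w. *)
Lemma ext_d_lie V w s : alt_cochain w ->
  ext_d (lie V w) s = lie V (ext_d w) s.
Proof.
elim: s w => [|U s IH] w walt; first by rewrite /= !ext_d_nil raddf0.
have aU := alternating_contr U walt; have aL := lie_alternating V walt.
rewrite cartan //= cartan // contr_ext_d //.
rewrite (_ : contr U (lie V w) = lie V (contr U w) - contr (bracket V U) w) //.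
rewrite (raddfB (@ext_d R M S)) (raddfB (lie V)) /= !fctE IH // lie_bracket //; ring.
Qed.

(** By Cartan's formula, i_U d d = L_U d - d L_U + d d i_U, and L_U commutes
    with d. *)
Lemma ext_d_d w : alt_cochain w -> ext_d (ext_d w) = 0.
Proof.
move=> walt; apply/funext => s; elim: s w walt => [|U s IH] w walt.
  exact: ext_d_nil.
have aU := alternating_contr U walt.
rewrite cartan; last exact: ext_d_alternating.
by rewrite contr_ext_d // raddfB /= !fctE IH // ext_d_lie // [X in _ - (_ - X)]/(0 s) subr0 subrr.
Qed.

End Cartan.

(** * Types of forms *)

Lemma big_tuple_bool (V : nmodType) n (P : pred (seq bool)) (F : seq bool -> V) :
  \sum_(b : n.+1.-tuple bool | P b) F b =
  \sum_(b : n.-tuple bool | P (true :: b)) F (true :: b) +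
  \sum_(b : n.-tuple bool | P (false :: b)) F (false :: b).
Proof.
pose h (x : bool * n.-tuple bool) := [tuple of x.1 :: x.2].
rewrite (reindex h) /=; last first.
  exists (fun t => (thead t, [tuple of behead t])) => [[b t] _|t _].
    by congr (_, _); apply: val_inj.
  by rewrite /h /= [RHS]tuple_eta.
rewrite -(pair_big_dep xpredT (fun b (t : n.-tuple bool) => P (b :: t))
  (fun b (t : n.-tuple bool) => F (b :: t))) /=.
by rewrite big_bool.
Qed.

Section Types.
Context (R : realType) (M : Type) (S : fun_algebra R M).
Local Notation A := (smooth_fun S).
Local Notation vf := (vfield S).
Local Notation cochain := (cochain S).
Local Notation cst_fun := (cst_fun S).
Implicit Types (U V W : vf) (f g : A) (w : cochain) (s : seq vf).

Lemma cst_funM (a b : R[i]) : cst_fun (a * b) = cst_fun a * cst_fun b.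
Proof. by rewrite /Defs.cst_fun -scalerA vf_scaleE. Qed.

Lemma cst_fun1 : cst_fun 1 = 1.
Proof. exact: scale1r. Qed.

Lemma cst_funD (a b : R[i]) : cst_fun (a + b) = cst_fun a + cst_fun b.
Proof. exact: scalerDl. Qed.

Lemma cst_funN (a : R[i]) : cst_fun (- a) = - cst_fun a.
Proof. exact: scaleNr. Qed.

Lemma vf_cst (a : R[i]) V : V (cst_fun a) = 0.
Proof.
have V1 : V 1 = 0.
  apply: (addIr (V 1)).
  by rewrite add0r -[in RHS](mulr1 1) vf_leibniz mulr1 mul1r.
by rewrite -[cst_fun a]addr0 (vf_linear V a 1 0) V1 (raddf0 V) addr0; exact: scaler0.
Qed.

Variable J : {linear vf -> vf}.
Hypothesis J2 : forall V, J (J V) = - V.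

Definition eigenval (b : bool) : A := cst_fun (if b then 'i%C else - 'i%C).

Definition has_type (b : bool) V := J V = eigenval b *: V.

Definition type_proj (b : bool) := if b then proj10 J else proj01 J.

Arguments type_proj : simpl never.

Lemma is10E V : is10 J V <-> has_type true V. Proof. by []. Qed.

Lemma is01E V : is01 J V <-> has_type false V.
Proof. by rewrite /has_type /eigenval cst_funN scaleNr. Qed.

Lemma eigenval2 b : eigenval b * eigenval b = -1.
Proof.
have E : ('i%C * 'i%C : R[i]) = -1 by rewrite -expr2 sqr_i.
by rewrite -cst_funM -cst_fun1 -cst_funN; congr (cst_fun _); case: b;
   rewrite ?mulrNN.
Qed.

Lemma eigenvalN b : eigenval (~~ b) = - eigenval b.
Proof. by rewrite -cst_funN; congr (cst_fun _); case: b; rewrite ?opprK. Qed.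

Lemma half_fun2 : cst_fun 2^-1 + cst_fun 2^-1 = 1.
Proof.
rewrite -cst_funD -cst_fun1; congr (cst_fun _).
by field.
Qed.

Lemma projE b V : type_proj b V = cst_fun 2^-1 *: (V - eigenval b *: J V).
Proof. by case: b => //=; rewrite /proj01 /eigenval cst_funN scaleNr opprK. Qed.

Lemma proj_linear b f V W : type_proj b (f *: V + W) = f *: type_proj b V + type_proj b W.
Proof.
rewrite !projE linearP /= [eigenval b *: (_ + _)]scalerDr opprD addrACA scalerDr; congr (_ + _).
rewrite [eigenval b *: (f *: _)]scalerA [eigenval b * f]mulrC -[(f * _) *: _]scalerA -scalerBr.
by rewrite !scalerA [_ * f]mulrC.
Qed.

Lemma proj_sum V : type_proj true V + type_proj false V = V.
Proof.
rewrite !projE -scalerDr addrACA (eigenvalN true) scaleNr opprK addNr addr0.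
by rewrite scalerDr -scalerDl half_fun2 scale1r.
Qed.

Lemma has_type_proj b V : has_type b (type_proj b V).
Proof.
rewrite /has_type !projE linearZ /= linearB linearZ /= J2.
rewrite scalerA [_ * cst_fun _]mulrC -scalerA; congr (_ *: _).
by rewrite scalerBr scalerA eigenval2 scaleN1r scalerN !opprK addrC.
Qed.

Lemma proj_id b V : has_type b V -> type_proj b V = V.
Proof.
rewrite projE => ->; rewrite scalerA eigenval2 scaleN1r opprK.
by rewrite scalerDr -scalerDl half_fun2 scale1r.
Qed.

Lemma proj_negb b V : has_type b V -> type_proj (~~ b) V = 0.
Proof.
rewrite projE => ->.
by rewrite eigenvalN scalerA mulNr eigenval2 opprK scale1r subrr scaler0.
Qed.

(** With J V = e V and J W = e W, where e is constant and e^2 = -1, the vanishing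
    of the Nijenhuis tensor reads - X = X + 2 e J X for X = [V, W]. *)
Lemma has_type_bracket b V W : integrable_structure J ->
  has_type b V -> has_type b W -> has_type b (bracket V W).
Proof.
move=> Jint JV JW; have := Jint V W; rewrite JV JW.
have brl (X Y : vf) : bracket (eigenval b *: X) Y = eigenval b *: bracket X Y.
  by rewrite bracketZl vf_cst scale0r subr0.
have brr (X Y : vf) : bracket X (eigenval b *: Y) = eigenval b *: bracket X Y.
  by rewrite bracketZr vf_cst scale0r addr0.
rewrite !(brl, brr) scalerA eigenval2 scaleN1r linearD linearZ /= /has_type.
set X := bracket V W; set e := eigenval b => E.
have h2 := half_fun2; set h := cst_fun 2^-1 in h2.
have e2 : e * e = -1 := eigenval2 b.
have {}E : (e + e) *: J X = - (X + X).
  by rewrite scalerDl; apply: (addrI X); rewrite -E opprD addrA subrr add0r.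
have -> : J X = (- h * e) *: ((e + e) *: J X).
  rewrite scalerA (_ : - h * e * (e + e) = - (h + h) * (e * e)); last by ring.
  by rewrite h2 e2 mulrNN mulr1 scale1r.
by rewrite E scalerN scalerDr -scalerDl -scaleNr; congr (_ *: _); rewrite -[RHS]mul1r -h2; ring.
Qed.

(** The list of booleans records the type of each argument, [true] for (1,0);
    a zero vector field has both types. *)
Fixpoint homogeneous (b : seq bool) s : Prop :=
  match b, s with
  | [::], [::] => True
  | b0 :: b', V :: s' => has_type b0 V /\ homogeneous b' s'
  | _, _ => False
  end.

(** For a form of degree k, this says that the component of type (c, k - c) is 0. *)
Definition vanishes_at (c : nat) w : Prop :=
  forall b s, homogeneous b s -> count id b = c -> w s = 0.

(** Every vector field is the sum of its two components, so a multilinear map is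
    determined by its values on homogeneous arguments. *)
Lemma homogeneous_ext w : alt_cochain w ->
  (forall b s, homogeneous b s -> w s = 0) -> w = 0.
Proof.
move=> walt w0; apply/funext => s; elim: s w walt w0 => [|V s IH] w walt w0.
  exact: (w0 [::]).
rewrite -(proj_sum V) (alt_slotD walt [::]) /=.
have E b : w (type_proj b V :: s) = 0.
  apply: (IH (contr (type_proj b V) w)); first exact: alternating_contr.
  by move=> b' s' hs; apply: (w0 (b :: b')); split=> //; exact: has_type_proj.
by rewrite !E addr0.
Qed.

Lemma vanishes_contr b V c w : has_type b V ->
  vanishes_at (b + c)%N w -> vanishes_at c (contr V w).
Proof. by move=> tV w0 b' s hs cb; apply: (w0 (b :: b')) => //=; rewrite cb. Qed.

Section Lie.
Hypothesis Jint : integrable_structure J.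

(** [V, U] may have components of both types, whence the two conditions. *)
Lemma vanishes_bracket w V U c b s : alt_cochain w ->
  vanishes_at c w -> vanishes_at c.+1 w ->
  homogeneous b s -> count id b = c -> w (bracket V U :: s) = 0.
Proof.
move=> walt w0 w1 hs cb; rewrite -(proj_sum (bracket V U)).
rewrite (alt_slotD walt [::]) /=.
rewrite (w1 (true :: b)) ?(w0 (false :: b)) ?addr0 //=; rewrite ?cb //.
all: by split=> //; exact: has_type_proj.
Qed.

(** Replacing an argument U by [V, U], with V of type (1,0), keeps the number of
    arguments of type (1,0) or raises it by one; for V of type (0,1), in
    [vanishes_lie01], the number stays or drops by one. *)
Lemma vanishes_lie10 V c w : alt_cochain w -> has_type true V ->
  vanishes_at c w -> vanishes_at c.+1 w -> vanishes_at c (lie V w).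
Proof.
move=> walt tV w0 w1 b s; elim: s b c w walt w0 w1 => [|U s IH] [|b0 b] c w walt w0 w1 //=.
  by move=> hs cb; rewrite (w0 [::] [::]) ?raddf0.
move=> [tU hs] cb; have aU := alternating_contr U walt.
have cU : vanishes_at (count id b) (contr U w).
  by apply: vanishes_contr tU _; rewrite cb.
have cU1 : vanishes_at (count id b).+1 (contr U w).
  by apply: vanishes_contr tU _; rewrite addnS cb.
rewrite (IH _ (count id b) _ _ cU cU1 hs) // sub0r; apply/eqP; rewrite oppr_eq0; apply/eqP.
case: b0 tU cb => tU cb.
  by apply: (w0 (true :: b)) => //; split=> //; exact: has_type_bracket.
by apply: vanishes_bracket walt w0 w1 hs cb.
Qed.

Lemma vanishes_lie01 V c w : alt_cochain w -> has_type false V ->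
  vanishes_at c w -> (forall c', c = c'.+1 -> vanishes_at c' w) ->
  vanishes_at c (lie V w).
Proof.
move=> walt tV w0 w1 b s; elim: s b c w walt w0 w1 => [|U s IH] [|b0 b] c w walt w0 w1 //=.
  by move=> hs cb; rewrite (w0 [::] [::]) ?raddf0.
move=> [tU hs] cb; have aU := alternating_contr U walt.
have cU : vanishes_at (count id b) (contr U w).
  by apply: vanishes_contr tU _; rewrite cb.
have cU1 c' : count id b = c'.+1 -> vanishes_at c' (contr U w).
  by move=> cc; apply: vanishes_contr tU _; apply: w1; rewrite -cb cc addnS.
rewrite (IH _ (count id b) _ _ cU cU1 hs) // sub0r; apply/eqP; rewrite oppr_eq0; apply/eqP.
case: b0 tU cb => tU cb; last first.
  by apply: (w0 (false :: b)) => //; split=> //; exact: has_type_bracket.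
by apply: vanishes_bracket walt (w1 _ (esym cb)) _ hs erefl; rewrite -add1n cb.
Qed.

(** The component of d w with c arguments of type (1,0) only depends on the
    components of w with c or c - 1 such arguments: by integrability, no term of
    the Koszul formula loses or gains more than that. *)
Lemma vanishes_ext_d c w : alt_cochain w -> vanishes_at c w ->
  (forall c', c = c'.+1 -> vanishes_at c' w) -> vanishes_at c (ext_d w).
Proof.
move=> walt w0 w1 b s; elim: s b c w walt w0 w1 => [|V s IH] [|b0 b] c w walt w0 w1 //=.
  by rewrite ext_d_nil.
move=> [tV hs] cb; have aV := alternating_contr V walt.
rewrite cartan // (IH b (count id b) (contr V w)) ?subr0 //.
- case: b0 tV cb => tV cb.
    apply: (@vanishes_lie10 V (count id b)) hs _ => //; first exact: w1.
    by rewrite -add1n cb.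
  by apply: (@vanishes_lie01 V c) hs _ => //; exact: w1.
- by apply: vanishes_contr tV _; rewrite cb.
- by move=> c' cc; apply: vanishes_contr tV _; apply: w1; rewrite -cb cc addnS.
Qed.

End Lie.

Lemma pq_component_nil p w : pq_component J p w [::] = if p == 0 then w [::] else 0.
Proof.
rewrite /pq_component /=; case: eqP => [->|/eqP p0].
  by rewrite (big_pred1 [tuple]) // => -[[|? ?] ?] //=.
by rewrite big_pred0 // => -[[|? ?] ?] //=; rewrite eq_sym (negbTE p0).
Qed.

(** The recursion that replaces the sum over bit vectors in all later proofs. *)
Lemma pq_component_cons p w V s : pq_component J p w (V :: s) =
  (if p is p'.+1 then pq_component J p' (contr (type_proj true V) w) s else 0) +
  pq_component J p (contr (type_proj false V) w) s.
Proof.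
rewrite /pq_component /= (@big_tuple_bool _ _ (fun b => count id b == p)
  (fun b => w [seq (if x.1 then proj10 J x.2 else proj01 J x.2) | x <- zip b (V :: s)])) /=.
congr (_ + _).
by case: p => [|p]; [rewrite big_pred0|].
Qed.

Lemma pq_component_is_zmod_morphism p : zmod_morphism (@pq_component _ _ S J p).
Proof. by move=> w1 w2; apply/funext => s; rewrite !fctE /pq_component -sumrB. Qed.

HB.instance Definition _ p := GRing.isZmodMorphism.Build cochain cochain
  (@pq_component _ _ S J p) (pq_component_is_zmod_morphism p).

Lemma pq_componentM p f w : pq_component J p (fun s => f * w s) =
  (fun s => f * pq_component J p w s).
Proof. by apply/funext => s; rewrite /pq_component mulr_sumr. Qed.

Arguments pq_component : simpl never.

Lemma pq_component0 p s : pq_component J p 0 s = 0.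
Proof. by rewrite raddf0. Qed.

Lemma contr_proj b f V W w : alt_cochain w ->
  contr (type_proj b (f *: V + W)) w =
  (fun s => f * contr (type_proj b V) w s) + contr (type_proj b W) w.
Proof.
by move=> walt; apply/funext => s; rewrite proj_linear; exact: (walt.1 [::]).
Qed.

Lemma contr_swap V W w : alt_cochain w ->
  contr V (contr W w) = - contr W (contr V w).
Proof. by move=> walt; apply/funext => s; exact: (alt_swap walt [::]). Qed.

Lemma contr_alt V w : alt_cochain w -> contr V (contr V w) = 0.
Proof. by move=> walt; apply/funext => s; exact: (walt.2 [::]). Qed.

Lemma pq_component_alternating p w :
  alt_cochain w -> alt_cochain (pq_component J p w).
Proof.
move=> walt; split=> s1.
  elim: s1 p w walt => [|X s1 IH] p w walt s2 f U W /=.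
    rewrite !pq_component_cons !contr_proj // !raddfD /= !pq_componentM !fctE.
    by case: p => [|p]; rewrite ?raddfD /= ?pq_componentM ?fctE; ring.
  rewrite !pq_component_cons IH; last exact: alternating_contr.
  case: p => [|p]; first by ring.
  by rewrite IH; [ring|exact: alternating_contr].
elim: s1 p w walt => [|X s1 IH] p w walt s2 U /=; last first.
  rewrite pq_component_cons IH; last exact: alternating_contr.
  case: p => [|p]; first exact: addr0.
  by rewrite IH ?addr0 //; exact: alternating_contr.
have aT := contr_alt (type_proj true U) walt.
have aF := contr_alt (type_proj false U) walt.
have aTF := contr_swap (type_proj true U) (type_proj false U) walt.
case: p => [|[|p]]; rewrite !pq_component_cons ?aT ?aF ?aTF ?raddfN ?pq_component0 /= ?fctE; ring.
Qed.

Lemma pq_component_form p k w : is_form k w -> is_form k (pq_component J p w).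
Proof.
move=> /is_formP [w0 walt]; apply/is_formP; split; last exact: pq_component_alternating.
move=> s; elim: s p k w {walt} w0 => [|V s IH] p k w w0.
  by move=> k0; rewrite pq_component_nil w0 // if_same.
move=> sk; rewrite pq_component_cons.
case: k w0 sk => [|k] w0 sk.
  have E X : contr X w = 0 by apply/funext => s'; exact: w0.
  by rewrite !E; case: p => [|p]; rewrite ?pq_component0 addr0.
rewrite (IH p k) //; last by move=> s' s'k; exact: w0.
by case: p => [|p]; rewrite ?(IH p k) ?addr0 // => s' s'k; exact: w0.
Qed.

(** Projecting an argument to the type that it does not have gives 0, so only the
    bit vector of the actual types contributes. *)
Lemma pq_component_homogeneous p w b s : alt_cochain w -> homogeneous b s ->
  pq_component J p w s = if count id b == p then w s else 0.
Proof.
elim: s b p w => [|V s IH] [|b0 b] p w walt //=.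
  by move=> _; rewrite pq_component_nil eq_sym.
move=> [tV hs]; rewrite pq_component_cons.
have E : contr (type_proj (~~ b0) V) w = 0.
  by rewrite proj_negb //; apply/funext => s'; exact: (alt_slot0 walt [::]).
have aV := alternating_contr V walt.
case: b0 tV E => tV E; rewrite E (proj_id tV) ?pq_component0.
  by rewrite addr0; case: p => [|p] //; rewrite (IH b).
by case: p => [|p]; rewrite ?pq_component0 add0r (IH b).
Qed.

(** Vanishing on arguments sorted by type is vanishing on homogeneous arguments in
    any order, since moving an argument to the front only changes the sign. *)
Lemma is_pq_formP p q w : is_pq_form J p q w <->
  is_form (p + q)%N w /\ forall c, c != p -> vanishes_at c w.
Proof.
split=> [[fw w0]|[fw w0]]; split=> //; last first.
  move=> s1 s2 h1 h2 sp; apply: (w0 _ sp (nseq (size s1) true ++ nseq (size s2) false)).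
    elim: s1 h1 {sp} => [|V s1 IH] h1 /=.
      elim: s2 h2 => [|V s2 IH] h2 //=; split.
        by apply/is01E/h2; rewrite mem_head.
      by apply: IH => U Us; apply: h2; rewrite inE Us orbT.
    split; first by apply/is10E/h1; rewrite mem_head.
    by apply: IH => U Us; apply: h1; rewrite inE Us orbT.
  by rewrite count_cat !count_nseq mul1n mul0n addn0.
have [_ walt] := (is_formP _ _).1 fw.
move=> c cp b s hs cb.
have gen : forall b s s1 s2, homogeneous b s -> (forall V, V \in s1 -> is10 J V) ->
   (forall V, V \in s2 -> is01 J V) -> (size s1 + count id b)%N != p ->
   w (s1 ++ s2 ++ s) = 0.
  (* s is read from the left; its entries of type (1,0) go to the end of s1 and
     the others to the end of s2 *)
  elim=> [|b0 b' IH] [|V s'] s1 s2 //=.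
    by move=> _ h1 h2;  rewrite addn0 cats0; exact: w0.
  move=> [tV hs'] h1 h2; case: b0 tV => tV sp.
    apply: alt_move0 walt _ _ _ _ _.
    rewrite -cat_rcons; apply: IH => //.
      by move=> U; rewrite mem_rcons inE => /orP[/eqP ->//|]; exact: h1.
    by rewrite size_rcons addSnnS.
  rewrite -cat_rcons; apply: IH => // U.
  by rewrite mem_rcons inE => /orP[/eqP ->|]; [exact/is01E|exact: h2].
by apply: (gen b s [::] [::]) => //; rewrite cb.
Qed.

Lemma is_pq_form_alternating p q w : is_pq_form J p q w -> alt_cochain w.
Proof. by case=> /is_formP []. Qed.

Lemma pq_component_is_pq p q w :
  is_form (p + q)%N w -> is_pq_form J p q (pq_component J p w).
Proof.
move=> fw; apply/is_pq_formP; split; first exact: pq_component_form.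
have [_ walt] := (is_formP _ _).1 fw.
move=> c cp b s hs cb; rewrite (@pq_component_homogeneous p w b) //.
by rewrite cb (negbTE cp).
Qed.

Lemma homogeneous_inj w1 w2 : alt_cochain w1 -> alt_cochain w2 ->
  (forall b s, homogeneous b s -> w1 s = w2 s) -> w1 = w2.
Proof.
move=> a1 a2 e12; apply/eqP; rewrite -subr_eq0; apply/eqP.
apply: homogeneous_ext; first exact: alternatingB.
by move=> b s hs; rewrite !fctE (e12 b) // subrr.
Qed.

Lemma pq_component_pq p q p' w : is_pq_form J p q w ->
  pq_component J p' w = if p' == p then w else 0.
Proof.
move=> wpq; have walt := is_pq_form_alternating wpq.
have [_ w0] := (is_pq_formP _ _ _).1 wpq.
apply: homogeneous_inj.
- exact: pq_component_alternating.
- by case: ifP => // _; exact: alt_cochain0.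
move=> b s hs; rewrite (@pq_component_homogeneous p' w b) //.
case: (altP eqP) => [<-|cp]; case: (altP eqP) => // e.
  by rewrite (w0 _ e b).
by rewrite (w0 (count id b) _ b) //; rewrite -e.
Qed.

Hypothesis Jint : integrable_structure J.

Lemma ext_d_pq p q w : is_pq_form J p q w ->
  ext_d w = del_op J p w + delbar J p w.
Proof.
move=> wpq; have walt := is_pq_form_alternating wpq.
have [_ w0] := (is_pq_formP _ _ _).1 wpq.
have adw := ext_d_alternating walt.
rewrite -[delbar _ _ _]opprK; apply: homogeneous_inj => //.
  apply: alternatingB; first exact: pq_component_alternating.
  rewrite -[- _]add0r; apply: alternatingB; first exact: alt_cochain0.
  exact: pq_component_alternating.
move=> b s hs; rewrite opprK /del_op /delbar !fctE.
rewrite !(@pq_component_homogeneous _ _ b) //.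
case: (altP eqP) => [->|n1]; first by rewrite (gtn_eqF (ltnSn p)) addr0.
case: (altP eqP) => [_|n2]; first by rewrite add0r.
rewrite addr0; apply: (@vanishes_ext_d Jint (count id b)) hs _ => //; first exact: w0.
by move=> c' cc; apply: w0; rewrite cc eqSS in n1.
Qed.

Lemma del_op_pq p q w : is_pq_form J p q w -> is_pq_form J p.+1 q (del_op J p w).
Proof. by move=> [fw _]; apply: pq_component_is_pq; exact: ext_d_form. Qed.

Lemma delbar_pq p q w : is_pq_form J p q w -> is_pq_form J p q.+1 (delbar J p w).
Proof.
by move=> [fw _]; apply: pq_component_is_pq; rewrite addnS; exact: ext_d_form.
Qed.

End Types.

(** * Complex conjugation of forms *)

Section Conjugation.
Context (R : realType) (M : Type) (S : fun_algebra R M).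
Local Notation A := (smooth_fun S).
Local Notation vf := (vfield S).
Local Notation cochain := (cochain S).
Implicit Types (U V W : vf) (f g : A) (w : cochain) (s : seq vf).

Lemma conj_fun_is_zmod_morphism : zmod_morphism (@conj_fun _ _ S).
Proof. by move=> f g; apply/val_inj/funext => x; exact: rmorphB. Qed.

HB.instance Definition _ := GRing.isZmodMorphism.Build A A
  (@conj_fun _ _ S) conj_fun_is_zmod_morphism.

Lemma conj_funM f g : conj_fun (f * g) = conj_fun f * conj_fun g.
Proof. by apply/val_inj/funext => x; exact: rmorphM. Qed.

Lemma conj_funK : involutive (@conj_fun _ _ S).
Proof. by move=> f; apply/val_inj/funext => x; exact: conjcK. Qed.

Lemma conj_cst_fun a : conj_fun (cst_fun S a) = cst_fun S (conjc a).
Proof.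
apply/val_inj/funext => x; rewrite /= /GRing.scale /=.
rewrite rmorphM /=; congr (_ * _); exact: conjc1.
Qed.

Lemma vf_conjE V f : vf_conj V f = conj_fun (V (conj_fun f)).
Proof. by []. Qed.

Lemma vf_conj_linear f V W :
  vf_conj (f *: V + W) = conj_fun f *: vf_conj V + vf_conj W.
Proof.
apply: vfieldP => g; rewrite vf_addE vf_scaledE !vf_conjE.
by rewrite vf_addE vf_scaledE raddfD /= conj_funM.
Qed.

Lemma vf_conjK : involutive (@vf_conj _ _ S).
Proof. by move=> V; apply: vfieldP => f; rewrite !vf_conjE !conj_funK. Qed.

Lemma vf_conj_bracket V W :
  vf_conj (bracket V W) = bracket (vf_conj V) (vf_conj W).
Proof.
by apply: vfieldP => f; rewrite bracketE !vf_conjE bracketE raddfB /= !conj_funK.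
Qed.

Definition conj_cochain w : cochain := fun s => conj_fun (w (map (@vf_conj _ _ S) s)).

Lemma conj_cochain_is_zmod_morphism : zmod_morphism conj_cochain.
Proof. by move=> w1 w2; apply/funext => s; exact: raddfB. Qed.

HB.instance Definition _ := GRing.isZmodMorphism.Build cochain cochain
  conj_cochain conj_cochain_is_zmod_morphism.

Lemma conj_cochainK : involutive conj_cochain.
Proof.
move=> w; apply/funext => s; rewrite /conj_cochain conj_funK -map_comp map_id_in //.
by move=> V _; exact: vf_conjK.
Qed.

Lemma conj_cochain_alternating w : alt_cochain w -> alt_cochain (conj_cochain w).
Proof.
move=> [wl wa]; split=> [s1 s2 f V W|s1 s2 V]; rewrite /conj_cochain !map_cat /=.
  by rewrite vf_conj_linear wl raddfD /= conj_funM conj_funK.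
by rewrite wa raddf0.
Qed.

Lemma conj_cochain_form k w : is_form k w -> is_form k (conj_cochain w).
Proof.
move=> /is_formP [w0 walt]; apply/is_formP; split; last exact: conj_cochain_alternating.
by move=> s sk; rewrite /conj_cochain w0 ?raddf0 // size_map.
Qed.

Lemma lie_conj_cochain V w s :
  lie V (conj_cochain w) s = conj_fun (lie (vf_conj V) w (map (@vf_conj _ _ S) s)).
Proof.
elim: s w => [|U s IH] w /=; first by rewrite conj_funK.
rewrite (_ : contr U (conj_cochain w) = conj_cochain (contr (vf_conj U) w)) // IH raddfB /=.
by rewrite /conj_cochain /= vf_conj_bracket.
Qed.

Lemma ext_d_conj_cochain w : alt_cochain w -> ext_d (conj_cochain w) = conj_cochain (ext_d w).
Proof.
move=> walt; apply/funext => s; elim: s w walt => [|V s IH] w walt.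
  by rewrite /conj_cochain !ext_d_nil raddf0.
rewrite cartan; last exact: conj_cochain_alternating.
rewrite lie_conj_cochain (_ : contr V (conj_cochain w) = conj_cochain (contr (vf_conj V) w)) // IH.
  by rewrite /conj_cochain /= cartan // raddfB.
exact: alternating_contr.
Qed.

Variable J : {linear vf -> vf}.
Hypothesis Jac : almost_complex J.

Lemma has_type_conj b V : has_type J b V -> has_type J (~~ b) (vf_conj V).
Proof.
rewrite /has_type Jac.2 => ->.
have -> : vf_conj (eigenval S b *: V) = conj_fun (eigenval S b) *: vf_conj V.
  by apply: vfieldP => f; rewrite vf_scaledE !vf_conjE vf_scaledE conj_funM.
have E : conjc (if b then 'i%C else - 'i%C) = if ~~ b then 'i%C else - 'i%C :> R[i].
  by case: b; apply/eqP; rewrite eq_complex /= ?oppr0 ?opprK !eqxx.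
by rewrite /eigenval conj_cst_fun E.
Qed.

Lemma homogeneous_conj b s : homogeneous J b s ->
  homogeneous J (map negb b) (map (@vf_conj _ _ S) s).
Proof.
elim: b s => [|b0 b IH] [|V s] //= [tV hs]; split; last exact: IH.
exact: has_type_conj.
Qed.

Lemma homogeneous_size b s : homogeneous J b s -> size b = size s.
Proof. by elim: b s => [|b0 b IH] [|V s] //= [_ /IH ->]. Qed.

Lemma conj_cochain_pq p q w : is_pq_form J p q w -> is_pq_form J q p (conj_cochain w).
Proof.
move=> /is_pq_formP [fw w0]; apply/is_pq_formP; split.
  by rewrite addnC; exact: conj_cochain_form.
move=> c cq b s hs cb; rewrite /conj_cochain.
have [ss|ss] := eqVneq (size s) (p + q)%N; last first.
  by have [w1 _] := (is_formP _ _).1 fw; rewrite w1 ?raddf0 // size_map.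
rewrite (w0 (count negb b) _ (map negb b)) ?raddf0 //.
- apply: contraNneq cq => E; apply/eqP/(@addnI p).
  by rewrite -ss -(homogeneous_size hs) -(count_predC negb b) E -cb;
     congr (_ + _)%N; apply: eq_count => x /=; rewrite negbK.
- exact: homogeneous_conj.
- by rewrite count_map; apply: eq_count.
Qed.

Hypothesis Jint : integrable_structure J.

(** Conjugating d = del + delbar, applied to the conjugate of w, and comparing
    types. *)
Lemma del_op_conj_cochain p q w : is_pq_form J p q w ->
  del_op J p w = conj_cochain (delbar J q (conj_cochain w)).
Proof.
move=> wpq; have J2 := Jac.1.
have cpq := conj_cochain_pq wpq.
have walt := is_pq_form_alternating wpq.
have E : ext_d w = conj_cochain (del_op J q (conj_cochain w)) + conj_cochain (delbar J q (conj_cochain w)).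
  rewrite -[in LHS](conj_cochainK w) (ext_d_conj_cochain (conj_cochain_alternating walt)).
  by rewrite (ext_d_pq J2 Jint cpq) raddfD.
rewrite {1}/del_op E raddfD /=.
rewrite (pq_component_pq J2 p.+1 (conj_cochain_pq (del_op_pq cpq))).
rewrite (pq_component_pq J2 p.+1 (conj_cochain_pq (delbar_pq cpq))).
by rewrite eqxx (gtn_eqF (ltnSn p)) add0r.
Qed.

End Conjugation.

(** * Pull-backs and invariant forms *)

Lemma smooth_valM (R : realType) (M : Type) (S : fun_algebra R M)
  (f g : smooth_fun S) x : (f * g) x = f x * g x.
Proof. by []. Qed.

Lemma smooth_valB (R : realType) (M : Type) (S : fun_algebra R M)
  (f g : smooth_fun S) x : (f - g) x = f x - g x.
Proof. by []. Qed.

Section Pullback.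
Context (R : realType) (M N : Type) (S : fun_algebra R M) (T : fun_algebra R N).
Variable F : M -> N.
Implicit Types (V : vfield S) (W : vfield T) (w : cochain T) (eta : cochain S).

Lemma F_related_bracket V1 V2 W1 W2 : F_related F V1 W1 -> F_related F V2 W2 ->
  F_related F (bracket V1 V2) (bracket W1 W2).
Proof.
move=> r1 r2 h f hf x.
have h1 := r1 _ _ hf; have h2 := r2 _ _ hf.
have e1 := r1 _ _ h2 x; have e2 := r2 _ _ h1 x.
by rewrite !bracketE !smooth_valB e1 e2.
Qed.

Lemma F_related_proj (JM : {linear vfield S -> vfield S})
    (JN : {linear vfield T -> vfield T}) b V W :
  F_related F V W -> F_related F (JM V) (JN W) ->
  F_related F (type_proj JM b V) (type_proj JN b W).
Proof.
move=> r rJ h f hf x; have e1 := r _ _ hf x; have e2 := rJ _ _ hf x.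
have eV (c : R[i]) : cst_fun S c x = cst_fun T c (F x) by [].
rewrite !projE !vf_scaledE !vf_addE !vf_oppE !vf_scaledE /eigenval.
by rewrite !smooth_valM !smooth_valB !smooth_valM e1 e2 !eV.
Qed.

Lemma F_related_conj V W : F_related F V W -> F_related F (vf_conj V) (vf_conj W).
Proof.
move=> r h f hf x; rewrite /=; congr conjc; apply: r => y /=.
by rewrite hf.
Qed.

Lemma pullback_contr V W w eta : F_related F V W ->
  is_pullback F w eta -> is_pullback F (contr W w) (contr V eta).
Proof.
move=> r pb s rs x; apply: (pb ((V, W) :: s)) => p.
by rewrite inE => /orP[/eqP ->|/rs].
Qed.

Lemma pullback_lie V W w eta : F_related F V W ->
  is_pullback F w eta -> is_pullback F (lie W w) (lie V eta).
Proof.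
move=> r pb s; elim: s w eta pb => [|[X Y] s IH] w eta pb rs x /=.
  by apply: r => y; exact: (pb [::]).
have rXY : F_related F X Y by apply: (rs (X, Y)); rewrite mem_head.
have rs' p : p \in s -> F_related F p.1 p.2.
  by move=> ps; apply: rs; rewrite inE ps orbT.
have e1 := IH _ _ (pullback_contr rXY pb) rs' x.
have e2 := pullback_contr (F_related_bracket r rXY) pb rs' x.
by rewrite -[LHS]/(lie V (contr X eta) (unzip1 s) x - contr (bracket V X) eta (unzip1 s) x) e1 e2.
Qed.

(** Related vector fields have related brackets, so the Koszul formulas for w and
    for its pull-back agree term by term; Cartan's formula organizes this as an
    induction on the arguments. *)
Lemma pullback_ext_d w eta : alt_cochain w -> alt_cochain eta ->
  is_pullback F w eta -> is_pullback F (ext_d w) (ext_d eta).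
Proof.
move=> aw ae pb s; elim: s w eta aw ae pb => [|[X Y] s IH] w eta aw ae pb rs x.
  by rewrite !ext_d_nil.
have rXY : F_related F X Y by apply: (rs (X, Y)); rewrite mem_head.
have rs' p : p \in s -> F_related F p.1 p.2.
  by move=> ps; apply: rs; rewrite inE ps orbT.
have aw' := alternating_contr Y aw; have ae' := alternating_contr X ae.
have e1 := IH _ _ aw' ae' (pullback_contr rXY pb) rs' x.
have e2 := pullback_lie rXY pb rs' x.
rewrite [unzip1 _]/= [unzip2 _]/= !cartan //.
by rewrite -[LHS]/(lie X eta (unzip1 s) x - ext_d (contr X eta) (unzip1 s) x) e1 e2.
Qed.

Lemma pullback_pq_component (JM : {linear vfield S -> vfield S})
    (JN : {linear vfield T -> vfield T}) p w eta :
  (forall V W, F_related F V W -> F_related F (JM V) (JN W)) ->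
  is_pullback F w eta ->
  is_pullback F (pq_component JN p w) (pq_component JM p eta).
Proof.
move=> rJ pb s; elim: s p w eta pb => [|[X Y] s IH] p w eta pb rs x.
  by rewrite /= !pq_component_nil; case: eqP => // _; exact: (pb [::]).
have rXY : F_related F X Y by apply: (rs (X, Y)); rewrite mem_head.
have rs' q : q \in s -> F_related F q.1 q.2.
  by move=> ps; apply: rs; rewrite inE ps orbT.
have e b q := IH q _ _ (pullback_contr (F_related_proj b rXY (rJ _ _ rXY)) pb) rs' x.
rewrite /= !pq_component_cons; case: p => [|p].
  by rewrite !add0r; exact: (e false).
by congr (_ + _); exact: e.
Qed.

Lemma pullback_conj_cochain w eta :
  is_pullback F w eta -> is_pullback F (conj_cochain w) (conj_cochain eta).
Proof.
move=> pb s rs x; rewrite /= /conj_cochain; congr conjc.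
have := pb [seq (vf_conj p.1, vf_conj p.2) | p <- s].
rewrite /unzip1 /unzip2 -!map_comp; apply=> q /mapP [p ps ->] /=.
exact: F_related_conj (rs _ ps).
Qed.

Lemma pullbackB w1 w2 eta1 eta2 : is_pullback F w1 eta1 ->
  is_pullback F w2 eta2 -> is_pullback F (w1 - w2) (eta1 - eta2).
Proof.
move=> pb1 pb2 s rs x; have e1 := pb1 s rs x; have e2 := pb2 s rs x.
by rewrite -[LHS]/(eta1 (unzip1 s) x - eta2 (unzip1 s) x) e1 e2.
Qed.

End Pullback.

Definition subgroup_of (U : zmodType) (X : set U) : Prop :=
  X 0 /\ forall x y, X x -> X y -> X (x - y).

Section Families.
Context (R : realType) (M : Type) (S : fun_algebra R M).
Local Notation vf := (vfield S).
Variable J : {linear vf -> vf}.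

(** What makes the bigraded pieces of a family of spaces of forms a double complex
    stable under conjugation. *)
Record closed_family (E : nat -> set (cochain S)) : Prop := ClosedFamily {
  family_subgroup : forall k, subgroup_of (E k) ;
  family_ext_d : forall k w, E k w -> E k.+1 (ext_d w) ;
  family_pq : forall k p w, E k w -> E k (pq_component J p w) ;
  family_conj : forall k w, E k w -> E k (conj_cochain w) }.

Lemma form_subgroup k : subgroup_of [set w : cochain S | is_form k w].
Proof.
split=> /=; first by apply/is_formP; split=> //; exact: alt_cochain0.
move=> w1 w2 /is_formP [z1 a1] /is_formP [z2 a2]; apply/is_formP; split.
  by move=> s sk; rewrite !fctE z1 // z2 // subr0.
exact: alternatingB.
Qed.

Lemma all_closed : closed_family (fun k => [set w | is_form k w]).
Proof.
split=> //=; [exact: form_subgroup|exact: ext_d_form|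
  by move=> k p w; exact: pq_component_form|exact: conj_cochain_form].
Qed.

End Families.

(** The pull-back to the group of d w, of a component of w or of the conjugate of w
    is obtained by the same operation from the pull-back of w, and the same holds
    for left translations; for components this uses the invariance of the complex
    structure. *)
Lemma invariant_closed (R : realType) (n : nat) (G : lieGroupType R n)
    (Gamma : subgroup G) (J : {linear vfield (SX Gamma) -> vfield (SX Gamma)}) :
  invariant_complex_structure J -> closed_family J (@invariant_forms R n G Gamma).
Proof.
move=> [JG [JGp JGl]]; split.
- move=> k; split.
    split; first exact: (form_subgroup _ k).1.
    by exists 0; split=> //; exact: (form_subgroup _ k).1.
  move=> w1 w2 [f1 [e1 [fe1 p1 l1]]] [f2 [e2 [fe2 p2 l2]]].
  split; first exact: (form_subgroup _ k).2.
  exists (e1 - e2); split; first exact: (form_subgroup _ k).2.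
    exact: pullbackB.
  by move=> g; exact: pullbackB.
- move=> k w [fw [eta [fe pe le]]]; split; first exact: ext_d_form.
  have [_ aw] := (is_formP _ _).1 fw; have [_ ae] := (is_formP _ _).1 fe.
  exists (ext_d eta); split; first exact: ext_d_form.
    exact: pullback_ext_d.
  by move=> g; exact: pullback_ext_d.
- move=> k p w [fw [eta [fe pe le]]]; split; first exact: pq_component_form.
  exists (pq_component JG p eta); split; first exact: pq_component_form.
    exact: pullback_pq_component.
  by move=> g; apply: pullback_pq_component => //; exact: JGl.
- move=> k w [fw [eta [fe pe le]]]; split; first exact: conj_cochain_form.
  exists (conj_cochain eta); split; first exact: conj_cochain_form.
    exact: pullback_conj_cochain.
  by move=> g; exact: pullback_conj_cochain.
Qed.

(** * Isomorphisms induced by an inclusion of complexes *)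

Section InducedIso.
Context (U : zmodType).
Implicit Types (Z B : set U).

Lemma subgroup_opp B x : subgroup_of B -> B x -> B (- x).
Proof. by move=> [B0 BB] Bx; rewrite -sub0r; exact: BB. Qed.

Lemma subgroup_add B x y : subgroup_of B -> B x -> B y -> B (x + y).
Proof.
by move=> sB Bx By; rewrite -[y]opprK; apply: sB.2 => //; exact: subgroup_opp.
Qed.

Lemma subgroup_image (V : zmodType) (f : {additive U -> V}) B :
  subgroup_of B -> subgroup_of (f @` B).
Proof.
move=> [B0 BB]; split; first by exists 0 => //; rewrite raddf0.
by move=> _ _ [x Bx <-] [y By <-]; exists (x - y); [exact: BB|rewrite raddfB].
Qed.

Lemma subgroup_0 : subgroup_of [set (0 : U)].
Proof. by split=> // x y -> ->; rewrite subr0. Qed.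

Lemma class_mod_eq B x y : subgroup_of B ->
  (class_mod B x = class_mod B y) <-> B (x - y).
Proof.
move=> sB; split=> [E|Bxy].
  have : class_mod B x x by rewrite /class_mod /= subrr; exact: sB.1.
  by rewrite E.
apply/seteqP; split=> z; rewrite /class_mod /= => Bz.
  by rewrite -(subrKA x); exact: subgroup_add.
by rewrite -(subrKA y); apply: subgroup_add => //; rewrite -opprB; exact: subgroup_opp.
Qed.

Lemma induced_isoP Z B Z' B' :
  subgroup_of Z -> subgroup_of B -> subgroup_of B' -> Z `<=` Z' -> B `<=` B' ->
  induced_iso Z B Z' B' <->
  (forall z', Z' z' -> exists2 z, Z z & B' (z' - z)) /\
  (forall z, Z z -> B' z -> B z).
Proof.
move=> sZ sB sB' ZZ BB.
have E z : induced_map B' (class_mod B z) = class_mod B' z.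
  apply/seteqP; split=> x; rewrite /induced_map /class_mod /=.
    by move=> [y By Bx]; rewrite -(subrKA y); apply: subgroup_add => //; exact: BB.
  by exists z => //; rewrite subrr; exact: sB.1.
split=> [[_ inj surj]|[surj inj]].
  split=> [z' Zz'|z Zz Bz].
    have [_ [z Zz <-]] := surj _ (ex_intro2 _ _ z' Zz' erefl).
    by rewrite E => /esym/(class_mod_eq _ _ sB') ?; exists z.
  have Zc y : Z y -> cohomology Z B (class_mod B y) by exists y.
  have := inj _ _ (mem_set (Zc _ Zz)) (mem_set (Zc _ sZ.1)).
  rewrite !E => /(_ _)/(class_mod_eq _ _ sB); rewrite subr0; apply.
  by apply/(class_mod_eq _ _ sB'); rewrite subr0.
split.
- by move=> _ [z Zz <-]; rewrite E; exists z => //; exact: ZZ.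
- move=> c1 c2 /set_mem [z1 Z1 <-] /set_mem [z2 Z2 <-]; rewrite !E.
  move=> /(class_mod_eq _ _ sB') B12; apply/(class_mod_eq _ _ sB).
  by apply: inj => //; exact: sZ.2.
- move=> _ [z' Zz' <-]; have [z Zz Bz] := surj _ Zz'.
  exists (class_mod B z); first by exists z.
  by rewrite E; apply/esym/(class_mod_eq _ _ sB').
Qed.

End InducedIso.

(** * Relative first-quadrant double complexes *)

Section DoubleComplex.
Context (U : zmodType) (D1 D2 : nat -> {additive U -> U}).
Variables A B : nat -> nat -> set U.
Hypothesis subA : forall p q, subgroup_of (A p q).
Hypothesis subB : forall p q, subgroup_of (B p q).
Hypothesis A1 : forall p q x, A p q x -> A p.+1 q (D1 p x).
Hypothesis A2 : forall p q x, A p q x -> A p q.+1 (D2 p x).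
Hypothesis B1 : forall p q x, B p q x -> B p.+1 q (D1 p x).
Hypothesis B2 : forall p q x, B p q x -> B p q.+1 (D2 p x).
Hypothesis D11 : forall p q x, B p q x -> D1 p.+1 (D1 p x) = 0.
Hypothesis D22 : forall p q x, B p q x -> D2 p (D2 p x) = 0.
Hypothesis D12 : forall p q x, B p q x -> D2 p.+1 (D1 p x) = - D1 p (D2 p x).

Definition image1 p q : set U :=
  if p is p'.+1 then D1 p' @` B p' q else [set 0].
Definition image2 p q : set U :=
  if q is q'.+1 then D2 p @` B p q' else [set 0].

(** [exact1] and [exact2] express, on representatives, that the quotient double
    complex B/A is exact for D1 and for D2. *)
Hypothesis exact1 : forall p q x, B p q x -> A p.+1 q (D1 p x) ->
  exists2 y, image1 p q y & A p q (x - y).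
Hypothesis exact2 : forall p q x, B p q x -> A p q.+1 (D2 p x) ->
  exists2 y, image2 p q y & A p q (x - y).

Lemma D1_image1 p q y : image1 p q y -> D1 p y = 0.
Proof. by case: p => [->|p [x Bx <-]]; [rewrite raddf0|exact: D11 Bx]. Qed.

Lemma D2_image2 p q y : image2 p q y -> D2 p y = 0.
Proof. by case: q => [->|q [x Bx <-]]; [rewrite raddf0|exact: D22 Bx]. Qed.

Lemma image1_B p q y : image1 p q y -> B p q y.
Proof. by case: p => [->|p [x Bx <-]]; [exact: (subB _ _).1|exact: B1]. Qed.

(** The Aeppli cohomology of B/A vanishes. Modulo A, the element D1 x is D2-closed,
    hence D1 x = D2 z' with z' of bidegree (p+1, q-1). As D1 D2 z' = 0, the
    induction hypothesis gives z' = D1 u + D2 v', so that D1 x = D2 D1 u, that is,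
    x + D2 u is D1-closed and hence D1-exact. For q = 0 there is no z' and
    D1 x = 0: this is where the complex being bounded is used. *)
Lemma aeppli_exact q p x : B p q x -> A p.+1 q.+1 (D1 p (D2 p x)) ->
  exists u v, [/\ image1 p q u, image2 p q v & A p q (x - u - v)].
Proof.
have step q' p' y : B p' q' y -> A p'.+1 q'.+1 (D1 p' (D2 p' y)) ->
    exists2 z, image2 p'.+1 q' z & A p'.+1 q' (D1 p' y - z).
  move=> By ddy; apply: exact2; first exact: B1.
  by rewrite (D12 By); exact: subgroup_opp.
elim: q p x => [|q IH] p x Bx ddx; have [z Iz Az] := step _ _ _ Bx ddx.
  have [|u Iu Au] := exact1 Bx; first by move: Az; rewrite Iz subr0.
  by exists u, 0; split=> //; rewrite subr0.
have [z' Bz' Ez] := Iz.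
have [|u' [v' [[u Bu Eu] Iv' Auv]]] := IH _ _ Bz'.
  rewrite Ez -[D1 _ z]opprK; apply: subgroup_opp => //.
  by rewrite -[- _]add0r -(D11 Bx) -raddfB; exact: A1.
have Av : A p.+1 q.+1 (z + D1 p (D2 p u)).
  have := A2 Auv; rewrite !raddfB /= (D2_image2 Iv') subr0 Ez -Eu (D12 Bu).
  by rewrite opprK.
have [||y Iy Ay] := @exact1 p q.+1 (x + D2 p u).
- by apply: subgroup_add => //; exact: B2.
- by rewrite raddfD -(subrKA z); exact: subgroup_add.
exists y, (- D2 p u); split=> //.
  by exists (- u); [exact: subgroup_opp|rewrite raddfN].
by rewrite opprK addrAC.
Qed.

Definition bc_image (X : nat -> nat -> set U) p q : set U :=
  match p, q with
  | p'.+1, q'.+1 => (D1 p' \o D2 p') @` X p' q'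
  | _, _ => [set 0]
  end.

(** The Bott-Chern cohomology of B/A vanishes. Modulo A, a closed z is D2 c, and
    D1 D2 c = 0, so c = D1 u' + D2 v and z = D2 D1 u' = - D1 D2 u'. The
    representative a in A is therefore z + D1 D2 u'. *)
Lemma bc_surjective p q z : B p q z -> D1 p z = 0 -> D2 p z = 0 ->
  exists2 a, [/\ A p q a, D1 p a = 0 & D2 p a = 0] & bc_image B p q (z - a).
Proof.
move=> Bz z1 z2.
(* in the bidegrees without D1 D2-image, z itself lies in A *)
have triv : A p q z -> exists2 a, [/\ A p q a, D1 p a = 0 & D2 p a = 0] &
    bc_image B p q (z - a).
  move=> Az; exists z => //; rewrite subrr.
  case: p q {z1 z2 Az Bz} => [|p] [|q] //.
  by exists 0; [exact: (subB _ _).1|rewrite /= !raddf0].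
have [|y Iy Ay] := exact2 Bz; first by rewrite z2; exact: (subA _ _).1.
case: q Bz triv Iy Ay => [|q] Bz triv; first by move=> ->; rewrite subr0.
move=> [c Bc Ec] Ay.
have [|u [v [Iu Iv Auv]]] := aeppli_exact Bc.
  rewrite Ec -[D1 p y]opprK; apply: subgroup_opp => //.
  by rewrite -[- _]add0r -z1 -raddfB; exact: A1.
have {Ay Auv} Au : A p q.+1 (z - D2 p u).
  have := A2 Auv; rewrite !raddfB /= (D2_image2 Iv) subr0 Ec => Ayu.
  by rewrite -(subrKA y); exact: subgroup_add.
case: p Bz z1 z2 triv Iu Au {y c v Bc Ec Iv} => [|p] Bz z1 z2 triv.
  by move=> ->; rewrite raddf0 subr0.
move=> [u' Bu' <-]; rewrite (D12 Bu') opprK => Aa.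
exists (z + D1 p (D2 p u')); last first.
  exists (- u'); first exact: subgroup_opp.
  by rewrite /= !raddfN opprD addrA subrr add0r.
split=> //; rewrite raddfD /= ?z1 ?z2 add0r; first exact: D11 (B2 Bu').
by rewrite (D12 (B2 Bu')) (D22 Bu') raddf0 oppr0.
Qed.

(** If a = D1 D2 b, then b = D1 u + D2 v modulo A; removing D1 u and D2 v from b
    gives an element of A with the same image under D1 D2. *)
Lemma bc_injective p q a : A p q a -> bc_image B p q a -> bc_image A p q a.
Proof.
case: p q => [|p] [|q] //= Aa [b Bb Eb].
have [|u [v [Iu Iv Auv]]] := aeppli_exact Bb; first by rewrite Eb.
exists (b - u - v) => //=; rewrite -Eb /= !raddfB /= (D2_image2 Iv) raddf0 subr0.
have -> : D1 p (D2 p u) = 0; last by rewrite subr0.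
by rewrite -[LHS]opprK -(D12 (image1_B Iu)) (D1_image1 Iu) raddf0 oppr0.
Qed.

End DoubleComplex.

(** * Bott-Chern cohomology *)

Section BottChern.
Context (R : realType) (M : Type) (S : fun_algebra R M).
Local Notation vf := (vfield S).
Local Notation cochain := (cochain S).
Variable J : {linear vf -> vf}.
Hypothesis Jac : almost_complex J.
Hypothesis Jint : integrable_structure J.
Let J2 := Jac.1.

Lemma del_op_is_zmod_morphism p : zmod_morphism (del_op J p).
Proof. by move=> w1 w2; rewrite /del_op !raddfB. Qed.

HB.instance Definition _ p := GRing.isZmodMorphism.Build cochain cochain
  (del_op J p) (del_op_is_zmod_morphism p).

Lemma delbar_is_zmod_morphism p : zmod_morphism (delbar J p).
Proof. by move=> w1 w2; rewrite /delbar !raddfB. Qed.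

HB.instance Definition _ p := GRing.isZmodMorphism.Build cochain cochain
  (delbar J p) (delbar_is_zmod_morphism p).

Lemma pq_subgroup p q : subgroup_of [set w | is_pq_form J p q w].
Proof.
have [F0 FB] := form_subgroup S (p + q)%N.
split; first by apply/is_pq_formP; split.
move=> x y /is_pq_formP [fx x0] /is_pq_formP [fy y0]; apply/is_pq_formP.
split; first exact: FB.
by move=> c cp b s hs cb; rewrite !fctE (x0 c cp b) // (y0 c cp b) // subr0.
Qed.

(** Forms of different types are linearly independent: take components. *)
Lemma pq_sum0 p a b c w0 w1 w2 : is_pq_form J p a w0 ->
  is_pq_form J p.+1 b w1 -> is_pq_form J p.+2 c w2 -> w0 + w1 + w2 = 0 ->
  [/\ w0 = 0, w1 = 0 & w2 = 0].
Proof.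
move=> f0 f1 f2 E; have E' q : pq_component J q (w0 + w1 + w2) = 0.
  by rewrite E raddf0.
have pE q := esym (E' q).
split; [move: (pE p)|move: (pE p.+1)|move: (pE p.+2)]; rewrite !raddfD /=;
  rewrite (pq_component_pq J2 _ f0) (pq_component_pq J2 _ f1)
    (pq_component_pq J2 _ f2) !(eqxx, eqSS).
- by rewrite (ltn_eqF (ltnSn p)) (ltn_eqF (ltnW (ltnSn p.+1))) !addr0.
- by rewrite (gtn_eqF (ltnSn p)) (ltn_eqF (ltnSn p)) addr0 add0r.
- by rewrite (gtn_eqF (ltnSn p)) (gtn_eqF (ltnW (ltnSn p.+1))) !add0r.
Qed.

(** The three components of d d w = 0 by type. *)
Lemma del_delbar_relations p q w : is_pq_form J p q w ->
  [/\ delbar J p (delbar J p w) = 0,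
      del_op J p.+1 (del_op J p w) = 0 &
      delbar J p.+1 (del_op J p w) = - del_op J p (delbar J p w)].
Proof.
move=> wpq; have walt := is_pq_form_alternating wpq.
have f1 := del_op_pq wpq; have f2 := delbar_pq wpq.
have := ext_d_d walt; rewrite (ext_d_pq J2 Jint wpq) raddfD /=.
rewrite (ext_d_pq J2 Jint f1) (ext_d_pq J2 Jint f2) => E.
have [] := @pq_sum0 p q.+2 q.+1 q (delbar J p (delbar J p w))
  (delbar J p.+1 (del_op J p w) + del_op J p (delbar J p w))
  (del_op J p.+1 (del_op J p w)).
- exact: delbar_pq.
- exact: subgroup_add (pq_subgroup _ _) (delbar_pq f1) (del_op_pq f2).
- exact: del_op_pq.
- by rewrite -E addrC [delbar _ _ (delbar _ _ _) + _]addrC !addrA.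
by move=> e0 /eqP e1 e2; split=> //; apply/eqP; rewrite -addr_eq0.
Qed.

Section Graded.
Variable E : nat -> set cochain.
Hypothesis EC : closed_family J E.

Lemma bigraded_subgroup p q : subgroup_of (bigraded J E p q).
Proof.
have [E0 EB] := family_subgroup EC (p + q)%N; have [F0 FB] := pq_subgroup p q.
by split=> // x y [Ex fx] [Ey fy]; split; [exact: EB|exact: FB].
Qed.

Lemma bigraded_del p q w : bigraded J E p q w -> bigraded J E p.+1 q (del_op J p w).
Proof.
move=> [Ew fw]; split; last exact: del_op_pq.
by apply: (family_pq EC); exact: (family_ext_d EC).
Qed.

Lemma bigraded_delbar p q w : bigraded J E p q w -> bigraded J E p q.+1 (delbar J p w).
Proof.
move=> [Ew fw]; split; last exact: delbar_pq.
by apply: (family_pq EC); rewrite addnS; exact: (family_ext_d EC).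
Qed.

Lemma bigraded_conj p q w : bigraded J E p q w -> bigraded J E q p (conj_cochain w).
Proof.
move=> [Ew fw]; split; last exact: conj_cochain_pq.
by rewrite /= addnC; exact: (family_conj EC).
Qed.

Lemma Z_Dol_subgroup p q : subgroup_of (Z_Dol J E p q).
Proof.
have [E0 EB] := bigraded_subgroup p q; split; first by split=> //; rewrite raddf0.
by move=> x y [Ex x0] [Ey y0]; split; [exact: EB|rewrite raddfB /= x0 y0 subr0].
Qed.

Lemma B_Dol_subgroup p q : subgroup_of (B_Dol J E p q).
Proof.
case: q => [|q]; first exact: subgroup_0.
exact: (subgroup_image _ (bigraded_subgroup p q)).
Qed.

Lemma Z_BC_subgroup p q : subgroup_of (Z_BC J E p q).
Proof.
have [E0 EB] := bigraded_subgroup p q; split; first by split=> //; rewrite raddf0.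
by move=> x y [Ex x0] [Ey y0]; split; [exact: EB|rewrite raddfB /= x0 y0 subr0].
Qed.

Lemma B_BC_subgroup p q : subgroup_of (B_BC J E p q).
Proof.
case: p q => [|p] [|q]; try exact: subgroup_0.
exact: (subgroup_image (del_op J p \o delbar J p) (bigraded_subgroup p q)).
Qed.

Lemma closed_pq p q w : is_pq_form J p q w ->
  ext_d w = 0 <-> del_op J p w = 0 /\ delbar J p w = 0.
Proof.
move=> fw; split=> [dw|[w1 w2]]; last by rewrite (ext_d_pq J2 Jint fw) w1 w2 addr0.
by rewrite /del_op /delbar dw !raddf0.
Qed.

End Graded.

Variables E F : nat -> set cochain.
Hypotheses (EC : closed_family J E) (FC : closed_family J F).
Hypothesis EF : forall k, E k `<=` F k.

Let EFpq p q : bigraded J E p q `<=` bigraded J F p q.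
Proof. by move=> w [Ew fw]; split=> //; exact: EF. Qed.

Hypothesis Dol_iso : forall p q, induced_iso (Z_Dol J E p q) (B_Dol J E p q)
                                             (Z_Dol J F p q) (B_Dol J F p q).

(** If delbar x is in E, it is the delbar of some x' in E by injectivity in
    Dolbeault cohomology; by surjectivity x - x' is an element z of E up to a
    delbar-exact form. *)
Lemma delbar_exact p q x : bigraded J F p q x ->
  bigraded J E p q.+1 (delbar J p x) ->
  exists2 y, B_Dol J F p q y & bigraded J E p q (x - y).
Proof.
move=> Fx Ex.
have iso r : (forall z', Z_Dol J F p r z' -> exists2 z, Z_Dol J E p r z &
      B_Dol J F p r (z' - z)) /\
    (forall z, Z_Dol J E p r z -> B_Dol J F p r z -> B_Dol J E p r z).
  apply/induced_isoP => //.
  - exact: Z_Dol_subgroup.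
  - exact: B_Dol_subgroup.
  - exact: B_Dol_subgroup.
  - by move=> w [Ew w0]; split=> //; exact: EFpq.
  - by case: r => [|r] // _ [w Ew <-]; exists w => //; exact: EFpq.
have [|x' Ex' dx'] := (iso q.+1).2 (delbar J p x) _ (ex_intro2 _ _ x Fx erefl).
  by split=> //; case: (del_delbar_relations Fx.2).
have Zx : Z_Dol J F p q (x - x').
  split; last by rewrite raddfB /= dx' subrr.
  by apply: (bigraded_subgroup FC p q).2 => //; exact: EFpq.
have [z [Ez _] Bz] := (iso q).1 _ Zx.
exists (x - x' - z) => //; rewrite !opprB addrCA [x + _]addrC subrK addrC.
exact: subgroup_add (bigraded_subgroup EC p q) _ _.
Qed.

(** The conjugate of [delbar_exact]. *)
Lemma del_exact p q x : bigraded J F p q x ->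
  bigraded J E p.+1 q (del_op J p x) ->
  exists2 y, image1 (fun p => del_op J p) (bigraded J F) p q y &
             bigraded J E p q (x - y).
Proof.
move=> Fx Ex; have Fcx := bigraded_conj FC Fx.
have [|y By Ey] := delbar_exact Fcx.
  have := bigraded_conj EC Ex.
  by rewrite (del_op_conj_cochain Jac Jint Fx.2) conj_cochainK.
exists (conj_cochain y); last first.
  by have := bigraded_conj EC Ey; rewrite raddfB /= conj_cochainK.
case: p By {Fx Ex Fcx Ey} => [->|p [w Fw <-]] /=; first by rewrite raddf0.
exists (conj_cochain w); first exact: bigraded_conj.
by rewrite (del_op_conj_cochain Jac Jint (bigraded_conj FC Fw).2) conj_cochainK.
Qed.

Lemma bott_chern_iso p q : induced_iso (Z_BC J E p q) (B_BC J E p q)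
                                         (Z_BC J F p q) (B_BC J F p q).
Proof.
apply/induced_isoP.
- exact: Z_BC_subgroup.
- exact: B_BC_subgroup.
- exact: B_BC_subgroup.
- by move=> w [Ew w0]; split=> //; exact: EFpq.
- by case: p q => [|p] [|q] // _ [w Ew <-]; exists w => //; exact: EFpq.
pose D1 p : {additive cochain -> cochain} := del_op J p.
pose D2 p : {additive cochain -> cochain} := delbar J p.
have rel p' q' w (Fw : bigraded J F p' q' w) := del_delbar_relations Fw.2.
have D11 p' q' w (Fw : bigraded J F p' q' w) : D1 p'.+1 (D1 p' w) = 0.
  by case: (rel _ _ _ Fw).
have D22 p' q' w (Fw : bigraded J F p' q' w) : D2 p' (D2 p' w) = 0.
  by case: (rel _ _ _ Fw).
have D12 p' q' w (Fw : bigraded J F p' q' w) :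
    D2 p'.+1 (D1 p' w) = - D1 p' (D2 p' w).
  by case: (rel _ _ _ Fw).
split.
  move=> z [Fz /(closed_pq Fz.2) [z1 z2]].
  have [a [Ea a1 a2] Ba] := @bc_surjective _ D1 D2 _ _
    (bigraded_subgroup EC) (bigraded_subgroup FC)
    (bigraded_del EC) (bigraded_delbar EC) (bigraded_del FC) (bigraded_delbar FC)
    D11 D22 D12 del_exact delbar_exact p q z Fz z1 z2.
  by exists a => //; split=> //; apply/(closed_pq Ea.2).
move=> a [Ea _] Ba.
exact: (@bc_injective _ D1 D2 _ _
    (bigraded_subgroup EC) (bigraded_subgroup FC)
    (bigraded_del EC) (bigraded_delbar EC) (bigraded_del FC) (bigraded_delbar FC)
    D11 D22 D12 del_exact delbar_exact p q a Ea Ba).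
Qed.

End BottChern.

Theorem theorem2p7 (R : realType) (n : nat) (G : lieGroupType R n)
  (G_connected : connected [set: G])
  (G_simply_connected : simply_connected R G)
  (G_solvable : solvable_group G)
  (Gamma : subgroup G)
  (Gamma_discrete : discrete_subset (subgroup_set Gamma))
  (Gamma_cocompact : compact [set: coset_space Gamma])
  (J : {linear vfield (SX Gamma) -> vfield (SX Gamma)})
  (J_almost_complex : almost_complex J)
  (J_integrable : integrable_structure J)
  (J_invariant : invariant_complex_structure J) :
  let inv := @invariant_forms R n G Gamma in
  let all := @all_forms R n G Gamma in
  (forall k, induced_iso (Z_dR inv k) (B_dR inv k) (Z_dR all k) (B_dR all k)) ->
  (forall p q, induced_iso (Z_Dol J inv p q) (B_Dol J inv p q)
                           (Z_Dol J all p q) (B_Dol J all p q)) ->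
  forall p q, induced_iso (Z_BC J inv p q) (B_BC J inv p q)
                          (Z_BC J all p q) (B_BC J all p q).
Proof.
move=> inv all _ Dol_iso; apply: bott_chern_iso => //.
- exact: invariant_closed.
- exact: all_closed.
- by move=> k w [].
Qed.
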